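(* There is an absolute constant $C\ge 1$ such that the following holds. Let $p$ be a sufficiently large odd prime (larger than an absolute constant), and let $A\subset \mathrm{Aff}(\mathbb{F}_p)$ be a symmetric set with $|A|\ge 2$. Let $\pi(A)=\{a:\ (a,b)\in A \text{ for some } b\}$ and $K=|A^3|/|A|$. Then at least one of the following alternatives holds: (i) $A\subseteq \mathrm{Stab}(x)$ for some $x\in\mathbb{F}_p$; or (ii)--(iii) for every $0<\epsilon<1$: (ii) if $|A|\le(1+\epsilon)p$, then $|\pi(A)|\le 2K^4$; (iii) otherwise (that is, if $|A|>(1+\epsilon)p$), $|\pi(A)|\le C\epsilon^{-C}K^3\frac{|A|}{p}$; in particular, if $|A|>4p$, then $|\pi(A)|\le 2K^3\frac{|A|}{p}$ and $A^8$ contains the $b$-axis $\{(1,b):b\in\mathbb{F}_p\}$. Moreover, claims (i), (ii) also apply over $\mathbb{R}$: if $A\subset\mathrm{Aff}(\mathbb{R})$ is a finite symmetric set with $|A|\ge 2$ and $K=|A^3|/|A|$, then either $A\subseteq\mathrm{Stab}(x)$ for some $x\in\mathbb{R}$, or $|\pi(A)|\le 2K^4$.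
   Context: For a field $\mathbb{F}$, $\mathrm{Aff}(\mathbb{F})$ is the group of invertible affine maps $x\mapsto ax+b$, $a\in\mathbb{F}^*$, $b\in\mathbb{F}$, written as pairs $(a,b)\in\mathbb{F}^*\times\mathbb{F}$ with product $(a,b)(c,d)=(ac,ad+b)$ and identity $(1,0)$. For $x\in\mathbb{F}$, $\mathrm{Stab}(x)=\{(a,b)\in\mathrm{Aff}(\mathbb{F}): ax+b=x\}$. A set $A$ is symmetric if $A=A^{-1}$, and $A^k$ denotes the $k$-fold product set of $A$. *)

(* Defs.v *)
From HB Require Import structures.
From mathcomp Require Import all_boot all_order all_algebra finmap.
From mathcomp Require Import all_classical all_reals all_analysis.

Set Implicit Arguments.
Unset Strict Implicit.
Unset Printing Implicit Defensive.

Import Order.TTheory GRing.Theory Num.Theory.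

Local Open Scope fset_scope.
Local Open Scope ring_scope.

Section AffineGroup.
Variable F : fieldType.

(* The pair (a, b) with a != 0 stands for the map x |-> a * x + b. *)
Record aff := Aff { aff_val : F * F; aff_valP : aff_val.1 != 0 }.

HB.instance Definition _ := [isSub for aff_val].
HB.instance Definition _ := [Choice of aff by <:].

Definition slope (g : aff) : F := (aff_val g).1.
Definition intercept (g : aff) : F := (aff_val g).2.
Definition aff_app (g : aff) (x : F) : F := slope g * x + intercept g.

Definition translation (b : F) : aff := @Aff (1, b) (oner_neq0 F).

Lemma aff_mul_subproof (g h : aff) : slope g * slope h != 0.
Proof. by rewrite mulf_neq0 // aff_valP. Qed.

Definition aff_mul (g h : aff) : aff :=
  @Aff (slope g * slope h, slope g * intercept h + intercept g)
       (aff_mul_subproof g h).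

Lemma aff_inv_subproof (g : aff) : (slope g)^-1 != 0.
Proof. by rewrite invr_neq0 // aff_valP. Qed.

Definition aff_inv (g : aff) : aff :=
  @Aff ((slope g)^-1, - ((slope g)^-1 * intercept g)) (aff_inv_subproof g).

Lemma aff_mulA : associative aff_mul.
Proof.
move=> g h k; apply: val_inj; rewrite /= /slope /intercept /=.
by congr pair; rewrite ?mulrA // mulrDr mulrA addrA.
Qed.

Lemma aff_mul1g : left_id (translation 0) aff_mul.
Proof.
case=> -[a b] ha; apply: val_inj; rewrite /= /slope /intercept /=.
by rewrite !mul1r addr0.
Qed.

Lemma aff_mulg1 : right_id (translation 0) aff_mul.
Proof.
case=> -[a b] ha; apply: val_inj; rewrite /= /slope /intercept /=.
by rewrite mulr1 mulr0 add0r.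
Qed.

Lemma aff_mulVg : left_inverse (translation 0) aff_inv aff_mul.
Proof.
case=> -[a b] ha; apply: val_inj; rewrite /= /slope /intercept /=.
by rewrite mulVf // subrr.
Qed.

Lemma aff_mulgV : right_inverse (translation 0) aff_inv aff_mul.
Proof.
case=> -[a b] ha; apply: val_inj; rewrite /= /slope /intercept /=.
by rewrite mulrN mulrA !mulfV // mul1r addNr.
Qed.

HB.instance Definition _ :=
  isGroup.Build aff aff_mulA aff_mul1g aff_mulg1 aff_mulVg aff_mulgV.

Definition Stab (x : F) : {pred aff} := [pred g : aff | aff_app g x == x].

Definition slopes (A : {fset aff}) : {fset F} := [fset slope g | g in A].

End AffineGroup.

Section ProductSets.
Variable G : groupType.
Implicit Types A B : {fset G}.

Definition prodset A B : {fset G} := [fset (g * h)%g | g in A, h in B].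

(* The k-fold product set A * ... * A; it is {1} for k = 0. *)
Definition powset A (k : nat) : {fset G} := iter k (prodset A) [fset 1%g].

Definition symset A : Prop := A = [fset (g^-1)%g | g in A].

End ProductSets.

Definition tripling (R : realType) (G : groupType) (A : {fset G}) : R :=
  (#|` powset A 3|)%:R / (#|` A|)%:R.

(* Main.v *)
Require Import Defs.
From mathcomp Require Import all_boot all_order all_algebra finmap.
From mathcomp Require Import all_classical all_reals all_analysis.
From mathcomp Require Import finfield zify ring lra.

Set Implicit Arguments.
Unset Strict Implicit.
Unset Printing Implicit Defensive.

Import Order.TTheory GRing.Theory Num.Theory.

Local Open Scope fset_scope.
Local Open Scope ring_scope.

(** An element (a, b) of the affine group is the line with equation a x + b,
    and the proof plays group growth against plane geometry.

    Growth. Suppose that two distinct lines of A meet above x, that is,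
    [secant A x]. Their quotient is an element of A^2 that fixes x and has a
    slope s different from 1; conjugating it by A gives, for every y in the
    orbit A x, an element of A^4 with slope s that fixes y. Multiplying these
    by one representative of each slope gives distinct elements of A^5, so
    |slopes A| |A x| <= |A^5|, and the Ruzsa triangle inequality bounds |A^5|
    by K^3 |A|.

    Averaging. Let D be a nonempty set of such x. Two lines meet at most once,
    so on average over D few pairs of lines of A agree at x, and some x in D
    has an orbit of size at least |A||D| / (|D| + |A| - 1). Together
      |slopes A| |D| <= K^3 (|D| + |A| - 1) ([slopes_secants_tripling]).
    If |A| > p then any x in F_p will do, by the pigeonhole principle. So D =
    F_p gives the bounds 2 K^3 |A| / p, and an orbit with more than p / 2
    points, whose differences therefore are all of F_p, gives all translations
    in A^8 ([translations_powset8]).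

    Geometry. If |A| <= p, or over the reals, a large D has to be found. The
    lines of A may be assumed not to be parallel, since then there is a single
    slope, and not to be concurrent (see below). Under these assumptions they
    meet above at least (|A| - 1) / 2 abscissae, which makes the bound above
    at most 3 K^3. Over the reals this is proved by sweeping a vertical line,
    as in the theorem of Ungar on directions ([card_abscissae]); over F_p by a
    lacunary polynomial, as in the work of Redei
    ([card_meeting_abscissae_prime_field]).

    Small tripling. 3 K^3 <= 2 K^4 as soon as K >= 3/2. If K < 3/2, then A^2
    is a subgroup. It contains a nontrivial translation, for otherwise it is
    abelian and fixes a point, and then the lines of A are concurrent. Over
    the reals no finite subgroup contains a nontrivial translation. Over F_p
    the subgroup contains all p translations, hence at least p |slopes A|
    elements; but A^2 has less than 3 |A| / 2 elements, and |A| <= (1 + eps) p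
    < 2 p here, which leaves at most two slopes.

    Finally, if all lines of A pass through one point (x, y), then so do the
    inverse lines through (y, x), and symmetry forces y = x, hence A to lie in
    Stab x, unless A has a single element. *)

(** * Finite sets and product sets *)

Lemma leq_card_fset_in (T U : choiceType) (A : {fset T}) (B : {fset U})
    (f : T -> U) :
  {in A &, injective f} -> (forall x, x \in A -> f x \in B) ->
  (#|` A| <= #|` B|)%N.
Proof.
move=> finj fAB.
have <- : #|` [fset f x | x in A]| = #|` A| by apply: card_in_imfset.
by apply/fsubset_leq_card/fsubsetP => y /imfsetP[x /= xA ->]; apply: fAB.
Qed.

Lemma card_fsetM (T U : choiceType) (A : {fset T}) (B : {fset U}) :
  #|` A `*` B| = (#|` A| * #|` B|)%N.
Proof.
rewrite -(size_allpairs pair); apply/perm_size/uniq_perm => //.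
  by apply: allpairs_uniq => // -[x y] [x' y'].
move=> [x y]; apply/idP/allpairsP.
  by rewrite in_fsetM => /andP[xA yB]; exists (x, y).
by move=> [[x' y'] [x'A y'B [-> ->]]]; rewrite in_fsetM; apply/andP.
Qed.

Lemma prodsetP (G : groupType) (A B : {fset G}) z :
  reflect (exists x y, [/\ x \in A, y \in B & z = (x * y)%g])
          (z \in prodset A B).
Proof.
apply: (iffP (imfset2P _ _ _ _ _)) => [[x xA [y yB ->]]|[x [y [xA yB ->]]]].
  by exists x, y.
by exists x => //; exists y.
Qed.

Lemma mem_prodset (G : groupType) (A B : {fset G}) x y :
  x \in A -> y \in B -> (x * y)%g \in prodset A B.
Proof. by move=> xA yB; apply/prodsetP; exists x, y. Qed.

Lemma prodsetA (G : groupType) : associative (@prodset G).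
Proof.
move=> A B C; apply/fsetP => z; apply/prodsetP/prodsetP.
  move=> [x [_ [xA /prodsetP[y [w [yB wC ->]]] ->]]].
  by exists (x * y)%g, w; rewrite mem_prodset // mulgA.
move=> [_ [w [/prodsetP[x [y [xA yB ->]]] wC ->]]].
by exists x, (y * w)%g; rewrite mem_prodset // mulgA.
Qed.

Lemma prodset1s (G : groupType) (A : {fset G}) : prodset [fset 1%g] A = A.
Proof.
apply/fsetP => z; apply/prodsetP/idP => [[x [y [/fset1P -> yA ->]]]|zA].
  by rewrite mul1g.
by exists 1%g, z; rewrite inE mul1g.
Qed.

Lemma powset_add (G : groupType) (A : {fset G}) m n :
  powset A (m + n) = prodset (powset A m) (powset A n).
Proof.
elim: m => [|m IHm]; first by rewrite prodset1s.
by rewrite /powset addSn !iterS -/(powset A (m + n)) IHm prodsetA.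
Qed.

Lemma powset1 (G : groupType) (A : {fset G}) : powset A 1 = A.
Proof.
apply/fsetP => z; apply/prodsetP/idP => [[x [y [xA /fset1P -> ->]]]|zA].
  by rewrite mulg1.
by exists z, 1%g; rewrite inE mulg1.
Qed.

Lemma mem_powset_mul (G : groupType) (A : {fset G}) m n x y :
  x \in powset A m -> y \in powset A n -> (x * y)%g \in powset A (m + n).
Proof. by rewrite powset_add; apply: mem_prodset. Qed.

Lemma symset_inv (G : groupType) (A : {fset G}) x :
  symset A -> x \in A -> (x^-1)%g \in A.
Proof. by move=> AV; rewrite {1}AV => /imfsetP[y /= yA ->]; rewrite invgK. Qed.

Lemma powset_inv (G : groupType) (A : {fset G}) k x :
  symset A -> x \in powset A k -> (x^-1)%g \in powset A k.
Proof.
move=> AV; elim: k x => [|k IHk] x.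
  by move=> /fset1P ->; rewrite invg1 inE.
rewrite -{1}addn1 powset_add powset1 => /prodsetP[y [z [yA zA ->]]].
by rewrite invgM -add1n mem_powset_mul ?powset1 ?IHk // symset_inv.
Qed.

(** Fix a factorization z = x y of each z in X Y.  The pair (a, z) is recovered
    from (x a^-1, a y), since the product of the two components is z. *)
Lemma ruzsa_triangle (G : groupType) (A X Y : {fset G}) :
  symset A ->
  (#|` A| * #|` prodset X Y| <= #|` prodset X A| * #|` prodset A Y|)%N.
Proof.
move=> AV.
have [w wP] : {w : G -> G * G & forall z, z \in prodset X Y ->
    [/\ (w z).1 \in X, (w z).2 \in Y & z = ((w z).1 * (w z).2)%g]}.
  apply: (@boolp.choice G _ (fun z w => z \in prodset X Y ->
    [/\ w.1 \in X, w.2 \in Y & z = (w.1 * w.2)%g])) => z.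
  case: (boolP (z \in prodset X Y)) => [|_]; last by exists (1%g, 1%g).
  by move=> /prodsetP[x [y xy]]; exists (x, y).
rewrite -!card_fsetM.
apply: (@leq_card_fset_in _ _ _ _
  (fun u => (((w u.2).1 * u.1^-1)%g, (u.1 * (w u.2).2)%g))).
  move=> [a z] [b t] /[!in_fsetM] /= /andP[aA zZ] /andP[bA tZ] [eq1 eq2].
  have [_ _ zE] := wP _ zZ; have [_ _ tE] := wP _ tZ.
  have ztE : z = t.
    have : ((w z).1 * a^-1 * (a * (w z).2))%g = ((w t).1 * b^-1 * (b * (w t).2))%g.
      by rewrite eq1 eq2.
    by rewrite !mulgA !mulgVK -zE -tE.
  by move: eq1; rewrite ztE => /mulgI/invg_inj ->.
move=> [a z] /[!in_fsetM] /= /andP[aA zZ]; have [xX yY _] := wP _ zZ.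
by rewrite !mem_prodset //; apply: symset_inv.
Qed.

(** Two applications of the triangle inequality: 4 = 2 + 2 and 5 = 2 + 3. *)
Lemma card_powset5 (G : groupType) (A : {fset G}) :
  symset A -> (#|` A| ^ 2 * #|` powset A 5| <= #|` powset A 3| ^ 3)%N.
Proof.
move=> AV.
have ruzsa m n : (#|` A| * #|` powset A (m + n)|
    <= #|` powset A (m + 1)| * #|` powset A (1 + n)|)%N.
  by rewrite !powset_add powset1; apply: ruzsa_triangle.
have : (#|` A| * #|` powset A 4| <= #|` powset A 3| * #|` powset A 3|)%N.
  exact: (ruzsa 2 2).
have : (#|` A| * #|` powset A 5| <= #|` powset A 3| * #|` powset A 4|)%N.
  exact: (ruzsa 2 3).
move: #|` A| #|` powset A 3| #|` powset A 4| #|` powset A 5| => n a b c; nia.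
Qed.

(** Padding by a a^-1; without 1 in A the powers of A need not be nested, but
    those of one parity are. *)
Lemma subset_powset (G : groupType) (A : {fset G}) k m :
  symset A -> A != fset0 -> {subset powset A k <= powset A (k + m.*2)}.
Proof.
move=> AV /fset0Pn[a aA] x xk.
have one : 1%g \in powset A m.*2.
  elim: m => [|m IHm]; first by rewrite inE.
  have -> : 1%g = ((a * a^-1) * 1)%g :> G by rewrite mulgV mulg1.
  rewrite doubleS -add2n; apply: mem_powset_mul => //.
  by rewrite -[2%N]addn1 mem_powset_mul ?powset1 // symset_inv.
by rewrite -[x]mulg1; apply: mem_powset_mul.
Qed.

(** If u = a b, then b A and a^-1 A lie in A^2, which is too small for them to
    overlap in less than half of A; so u A contains more than half of A.  For
    u, v in A^2 the sets u^-1 A and v A thus share an element of A, and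
    u^-1 g = v h exhibits u v as g h^-1. *)
Lemma powset2_closed (G : groupType) (A : {fset G}) u v :
  symset A -> (2 * #|` powset A 2| < 3 * #|` A|)%N ->
  u \in powset A 2 -> v \in powset A 2 -> (u * v)%g \in powset A 2.
Proof.
move=> AV small.
have mulE (x : G) : #|` [fset (x * g)%g | g in A]| = #|` A|.
  by apply: card_in_imfset => g h _ _ /mulgI.
have mem2 x y : x \in A -> y \in A -> (x * y)%g \in powset A 2.
  by move=> xA yA; rewrite -[2%N]addn1 mem_powset_mul ?powset1.
have half u0 : u0 \in powset A 2 ->
    (#|` A| < 2 * #|` [fset (u0 * g)%g | g in A] `&` A|)%N.
  rewrite -[2%N]addn1 powset_add !powset1 => /prodsetP[a [b [aA bA ->]]].
  set X := [fset (b * g)%g | g in A]; set Y := [fset (a^-1 * g)%g | g in A].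
  have cap : (#|` X `&` Y| <= #|` [fset (a * b * g)%g | g in A] `&` A|)%N.
    apply: (@leq_card_fset_in _ _ _ _ (fun x => (a * x)%g)) => [x y _ _ /mulgI //|x].
    move=> /fsetIP[/imfsetP[g /= gA ->] /imfsetP[h /= hA hE]].
    rewrite inE; apply/andP; split; last by rewrite hE mulgA mulgV mul1g.
    by apply/imfsetP; exists g; rewrite //= mulgA.
  have : (#|` X `|` Y| <= #|` powset A 2|)%N.
    apply/fsubset_leq_card/fsubsetP => x /fsetUP[] /imfsetP[g /= gA ->].
      exact: mem2.
    by apply: mem2 => //; apply: symset_inv.
  by have := cardfsUI X Y; rewrite !mulE; lia.
move=> uA vA.
have := half _ vA; have := half _ (powset_inv AV uA).
set X := _ `&` A; set Y := _ `&` A => hX hY.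
have cup : (#|` X `|` Y| <= #|` A|)%N.
  by apply/fsubset_leq_card; rewrite fsubUset !fsubsetIr.
have /fset0Pn[x] : X `&` Y != fset0.
  rewrite -cardfs_gt0; have := cardfsUI X Y; move: hX hY cup.
  by move: #|` A| #|` X| #|` Y| #|` X `|` Y| #|` X `&` Y| => a x y z w; lia.
move=> /fsetIP[/fsetIP[/imfsetP[g /= gA xg] xA] /fsetIP[/imfsetP[h /= hA xh] _]].
have -> : (u * v)%g = (g * h^-1)%g.
  by rewrite -[g](mulKg u^-1%g) -xg xh invgK -!mulgA mulgV mulg1.
by apply: mem2 => //; apply: symset_inv.
Qed.

Lemma sqr_sum_leq (T : Type) (s : seq T) (c : T -> nat) :
  ((\sum_(y <- s) c y) ^ 2 <= size s * \sum_(y <- s) c y ^ 2)%N.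
Proof.
have sumE (d : T -> nat) : (size s * \sum_(y <- s) d y = \sum_(y <- s) \sum_(z <- s) d z)%N.
  by rewrite big_const_seq count_predT iter_addn_0 mulnC.
rewrite -(leq_pmul2l (isT : (0 < 2)%N)) [leqRHS]mul2n -addnn.
rewrite {1}sumE exchange_big /= sumE -big_split /= -mulnn big_distrlr big_distrr /=.
apply: leq_sum => y _; rewrite big_distrr -big_split /=.
by apply: leq_sum => z _; exact: nat_Cauchy.
Qed.

(** Cauchy-Schwarz on the fibres of f: the double sum counts the pairs of
    elements of A with the same image. *)
Lemma card_imfset_energy (T U : choiceType) (A : {fset T}) (f : T -> U) :
  (#|` A| ^ 2
     <= #|` [fset f g | g in A]| * \sum_(g <- A) \sum_(h <- A) (f g == f h))%N.
Proof.
pose c y := (\sum_(h <- A) (y == f h))%N.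
have cE y : c y = (\sum_(h <- A | f h == y) 1)%N.
  by rewrite [RHS]big_mkcond; apply: eq_bigr => h _; rewrite eq_sym; case: ifP.
have -> : #|` A| = (\sum_(y <- [fset f g | g in A]) c y)%N.
  rewrite card_fset_sum1 (partition_big_imfset _ f) /=.
  by apply: eq_bigr => y _; rewrite cE.
have -> : (\sum_(g <- A) \sum_(h <- A) (f g == f h)
    = \sum_(y <- [fset f g | g in A]) c y ^ 2)%N.
  rewrite (partition_big_imfset _ f) /=; apply: eq_bigr => y _.
  rewrite (eq_bigr (fun=> c y)); first last.
    by move=> g /eqP gy; rewrite /c gy.
  by rewrite big_const_seq iter_addn_0 -mulnn -sum1_count -cE.
exact: sqr_sum_leq.
Qed.

(** * Affine maps and their meeting points *)

Lemma aff_eqP (F : fieldType) (g h : aff F) :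
  slope g = slope h -> intercept g = intercept h -> g = h.
Proof.
by case: g h => [[a b] ga] [[c d] hc] /= ac bd; apply: val_inj => /=; congr pair.
Qed.

Lemma aff_app_mul (F : fieldType) (g h : aff F) x :
  aff_app (g * h)%g x = aff_app g (aff_app h x).
Proof. by rewrite /aff_app /slope /intercept /= mulrDr addrA mulrA. Qed.

Lemma aff_app1 (F : fieldType) (x : F) : aff_app (1%g : aff F) x = x.
Proof. by rewrite /aff_app /= mul1r addr0. Qed.

Lemma aff_appK (F : fieldType) (g : aff F) : cancel (aff_app g) (aff_app g^-1%g).
Proof. by move=> x; rewrite -aff_app_mul mulVg aff_app1. Qed.

Lemma aff_app_inj (F : fieldType) (g : aff F) : injective (aff_app g).
Proof. exact: can_inj (aff_appK g). Qed.

Lemma slopeM (F : fieldType) (g h : aff F) : slope (g * h)%g = slope g * slope h.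
Proof. by []. Qed.

Lemma slopeV (F : fieldType) (g : aff F) : slope (g^-1)%g = (slope g)^-1.
Proof. by []. Qed.

Lemma slope_neq0 (F : fieldType) (g : aff F) : slope g != 0.
Proof. exact: aff_valP. Qed.

Lemma aff_eq_app (F : fieldType) (g h : aff F) x :
  slope g = slope h -> aff_app g x = aff_app h x -> g = h.
Proof.
by move=> gh; rewrite /aff_app gh => /addrI; apply: aff_eqP.
Qed.

Lemma aff_eq_app2 (F : fieldType) (g h : aff F) x y :
  x != y -> aff_app g x = aff_app h x -> aff_app g y = aff_app h y -> g = h.
Proof.
move=> xy eqx eqy; apply: (@aff_eq_app _ _ _ x) => //.
have xy0 : x - y != 0 by rewrite subr_eq0.
apply: (mulIf xy0); rewrite !mulrBr.
have := congr2 (fun u v => u - v) eqx eqy.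
by rewrite /aff_app /= !opprD !(addrACA _ _ (- _)) !subrr !addr0.
Qed.

Definition orbit_of (F : fieldType) (A : {fset aff F}) (x : F) : {fset F} :=
  [fset aff_app g x | g in A].

Definition secant (F : fieldType) (A : {fset aff F}) (x : F) : Prop :=
  exists g h, [/\ g \in A, h \in A, g != h & aff_app g x = aff_app h x].

(** The quotient of two lines that cross above x fixes x; its conjugate by k
    fixes k x and has the same slope. *)
Lemma conjugates_over_orbit (F : fieldType) (A : {fset aff F}) x :
  symset A -> secant A x ->
  exists2 s, s != 1 & forall y, y \in orbit_of A x ->
    exists c, [/\ c \in powset A 4, slope c = s & aff_app c y = y].
Proof.
move=> AV [g [h [gA hA gh ghx]]].
have fixE : aff_app (g^-1 * h)%g x = x by rewrite aff_app_mul -ghx aff_appK.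
exists (slope (g^-1 * h)%g).
  apply: contraNneq gh => s1.
  have : (g^-1 * h)%g = 1%g by apply: (@aff_eq_app _ _ _ x); rewrite ?aff_app1.
  by move/mulg1_eq; rewrite invgK => ->.
move=> y /imfsetP[k /= kA ->].
exists (k * (g^-1 * h) * k^-1)%g; split.
- apply: (@mem_powset_mul _ A 3 1); last by rewrite powset1 symset_inv.
  apply: (@mem_powset_mul _ A 1 2); first by rewrite powset1.
  by apply: (@mem_powset_mul _ A 1 1); rewrite powset1 ?symset_inv.
- by rewrite slopeM slopeM slopeV mulrAC mulfV ?slope_neq0 // mul1r.
- by rewrite aff_app_mul aff_appK aff_app_mul fixE.
Qed.

Lemma exists_slope_section (F : fieldType) (A : {fset aff F}) :
  {r : F -> aff F & forall s, s \in slopes A -> r s \in A /\ slope (r s) = s}.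
Proof.
apply: (@boolp.choice F _ (fun s g => s \in slopes A ->
  g \in A /\ slope g = s)) => s.
case: (boolP (s \in slopes A)) => [/imfsetP[g /= gA ->]|_]; first by exists g.
by exists 1%g.
Qed.

(** Multiply a representative of each slope by the element that fixes y.  The
    slope s of the second factor does not depend on y, so the slope of the
    product gives back the first factor, hence the second, hence its fixed
    point y. *)
Lemma card_slopes_orbit (F : fieldType) (A : {fset aff F}) x :
  symset A -> secant A x ->
  (#|` slopes A| * #|` orbit_of A x| <= #|` powset A 5|)%N.
Proof.
move=> AV xA; have [s s1 conj] := conjugates_over_orbit AV xA.
have [c cP] : {c : F -> aff F & forall y, y \in orbit_of A x ->
    [/\ c y \in powset A 4, slope (c y) = s & aff_app (c y) y = y]}.
  apply: (@boolp.choice F _ (fun y c => y \in orbit_of A x ->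
    [/\ c \in powset A 4, slope c = s & aff_app c y = y])) => y.
  case: (boolP (y \in orbit_of A x)) => [/conj[c cP]|_]; first by exists c.
  by exists 1%g.
have [r rP] := exists_slope_section A.
have cE y z : y \in orbit_of A x -> z \in orbit_of A x -> c y = c z -> y = z.
  move=> yO zO cyz; have [_ sy fy] := cP _ yO; have [_ _ fz] := cP _ zO.
  apply: contra_neq_eq s1 => yz; rewrite -sy.
  suff -> : c y = 1%g by [].
  by apply: (aff_eq_app2 yz); rewrite ?aff_app1 // cyz.
rewrite -card_fsetM.
apply: (@leq_card_fset_in _ _ _ _ (fun u => (r u.1 * c u.2)%g)).
  move=> [a y] [b z] /[!in_fsetM] /= /andP[aS yO] /andP[bS zO] eqrc.
  have [_ ra] := rP _ aS; have [_ rb] := rP _ bS.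
  have [_ sy _] := cP _ yO; have [_ sz _] := cP _ zO.
  have ab : a = b.
    have := congr1 (@slope F) eqrc; rewrite !slopeM ra rb sy sz.
    by apply: mulIf; rewrite -sy slope_neq0.
  by move: eqrc; rewrite ab => /mulgI/(cE _ _ yO zO) ->.
move=> [a y] /[!in_fsetM] /= /andP[aS yO].
have [rA _] := rP _ aS; have [cA _ _] := cP _ yO.
by apply: (@mem_powset_mul _ A 1 4); rewrite ?powset1.
Qed.

Lemma leq_sum_fset (T : choiceType) (A : {fset T}) (m n : T -> nat) :
  (forall x, x \in A -> (m x <= n x)%N) ->
  (\sum_(x <- A) m x <= \sum_(x <- A) n x)%N.
Proof.
by move=> mn; rewrite big_seq [leqRHS]big_seq; apply: leq_sum => x; apply: mn.
Qed.

(** E x counts the pairs of lines of A that agree at x.  Summed over D, a pair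
    of equal lines contributes |D| and a pair of distinct lines at most 1; an
    x with E x at most the average has a large orbit by Cauchy-Schwarz. *)
Lemma exists_large_orbit (F : fieldType) (A : {fset aff F}) (D : {fset F}) :
  D != fset0 ->
  exists2 x, x \in D &
    (#|` A| * #|` D| <= #|` orbit_of A x| * (#|` D| + #|` A|.-1))%N.
Proof.
move=> D0.
pose E x := (\sum_(g <- A) \sum_(h <- A) (aff_app g x == aff_app h x))%N.
have sumE : (\sum_(x <- D) E x <= #|` A| * (#|` D| + #|` A|.-1))%N.
  rewrite /E exchange_big /= card_fset_sum1 big_distrl /=.
  apply: leq_sum_fset => g gA.
  rewrite exchange_big /= (big_fsetD1 g) //= mul1n; apply: leq_add.
    rewrite card_fset_sum1; apply: leq_sum => x _.
    by case: (_ == _).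
  rewrite -card_fset_sum1 (cardfsD1 g A) gA add1n /= card_fset_sum1.
  apply: leq_sum_fset => h; rewrite !inE => /andP[hg hA].
  have [x xgh|none] := pickP (fun x : D => aff_app g (val x) == aff_app h (val x)).
    rewrite (big_fsetD1 (val x)) ?(valP x) //= big1_seq ?addn0; first by case: (_ == _).
    move=> y; rewrite !inE => /and3P[_ yx yD].
    case: eqP => // ygh; case/eqP: hg; symmetry.
    exact: (aff_eq_app2 yx ygh (eqP xgh)).
  rewrite big1_seq // => y /= yD; by have := none [` yD]; rewrite /= => ->.
have [x xD xE] : exists2 x, x \in D & (#|` D| * E x <= #|` A| * (#|` D| + #|` A|.-1))%N.
  apply: contrapT => /forall2NP none; have /fset0Pn[x0 x0D] := D0.
  suff : (\sum_(x <- D) #|` A| * (#|` D| + #|` A|.-1)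
      < \sum_(x <- D) #|` D| * E x)%N.
    rewrite big_const_seq count_predT iter_addn_0 mulnC -big_distrr /=.
    by rewrite ltnNge leq_mul2l sumE orbT.
  rewrite (big_fsetD1 x0) //= [ltnRHS](big_fsetD1 x0) //=.
  have lt x : x \in D -> (#|` A| * (#|` D| + #|` A|.-1) < #|` D| * E x)%N.
    by move=> xD; rewrite ltnNge; apply/negP; case: (none x).
  rewrite -addSn leq_add ?lt //; apply: leq_sum_fset => x.
  by rewrite !inE => /andP[_ /lt/ltnW].
exists x => //.
have := card_imfset_energy A (fun g => aff_app g x); rewrite -/(E x) -/(orbit_of A x) => CS.
have [->|n0] := posnP #|` A|; first by rewrite mul0n.
rewrite -(leq_pmul2l n0).
move: #|` A| #|` D| #|` orbit_of A x| (E x) xE CS n0 => n d o e xE CS n0.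
nia.
Qed.

Lemma card_slopes_secants (F : fieldType) (A : {fset aff F}) (D : {fset F}) :
  symset A -> D != fset0 -> (forall x, x \in D -> secant A x) ->
  (#|` slopes A| * #|` D| * #|` A| ^ 3
     <= #|` powset A 3| ^ 3 * (#|` D| + #|` A|.-1))%N.
Proof.
move=> AV D0 Dsec; have [x xD large] := exists_large_orbit A D0.
have := card_powset5 AV; have := card_slopes_orbit AV (Dsec x xD); move: large.
move: #|` slopes A| #|` D| #|` A| #|` orbit_of A x| #|` powset A 5|.
move: #|` powset A 3| => t s d n o m large so five.
apply: (@leq_trans (n ^ 2 * (s * (n * d)))); first by rewrite leq_eqVlt; apply/orP; left; apply/eqP; ring.
apply: (@leq_trans (n ^ 2 * (s * (o * (d + n.-1))))).
  by rewrite !leq_mul2l large !orbT.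
rewrite !mulnA leq_mul2r; apply/orP; right.
by apply: leq_trans five; rewrite -mulnA leq_mul2l so orbT.
Qed.

(** By symmetry the lines through (x, y) also pass through (y, x), and only one
    line does both unless x = y. *)
Lemma symset_concurrent_Stab (F : fieldType) (A : {fset aff F}) x y :
  symset A -> (2 <= #|` A|)%N -> (forall g, g \in A -> aff_app g x = y) ->
  {subset A <= Stab x}.
Proof.
move=> AV A2 gxy g gA; rewrite inE; apply/eqP; rewrite gxy //.
have gyx h : h \in A -> aff_app h y = x.
  move=> hA; rewrite -(gxy _ (symset_inv AV hA)) -{1}[h]invgK.
  by rewrite -aff_app_mul mulVg aff_app1.
apply: contraTeq A2 => yx; rewrite -ltnNge ltnS.
have -> : A = [fset g].
  apply/fsetP => h; rewrite inE; apply/idP/eqP => [hA|-> //].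
  by apply: (aff_eq_app2 yx); rewrite ?gyx ?gxy.
by rewrite cardfs1.
Qed.

(** * Sets with doubling below 3/2 *)

Lemma translationD (F : fieldType) (b c : F) :
  (translation b * translation c)%g = translation (b + c).
Proof.
by apply: aff_eqP; rewrite /slope /intercept /= mul1r // addrC.
Qed.

(** A^2 is a subgroup.  Commutators have slope 1, so without nontrivial
    translations it is abelian; the fixed point x of one nontrivial element is
    then fixed by all of A^2, and every h in A sends x to the point g^-1 x for
    any chosen g in A. *)
Lemma small_doubling_translation (F : fieldType) (A : {fset aff F}) :
  symset A -> (2 <= #|` A|)%N -> (2 * #|` powset A 2| < 3 * #|` A|)%N ->
  (forall x y, exists2 g, g \in A & aff_app g x != y) ->
  exists2 b, b != 0 & translation b \in powset A 2.
Proof.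
move=> AV A2 small spread.
have mulH u v := @powset2_closed _ _ u v AV small.
have invH u := @powset_inv _ _ 2 u AV.
have mem2 g h : g \in A -> h \in A -> (g * h)%g \in powset A 2.
  by move=> gA hA; rewrite -[2%N]addn1 mem_powset_mul ?powset1.
apply: contrapT => /forall2NP noT.
have slope1 u : u \in powset A 2 -> slope u = 1 -> u = 1%g.
  move=> uH u1; have uT : u = translation (intercept u) by apply: aff_eqP.
  case: (noT (intercept u)) => [/negP/negPn/eqP b0|]; last by rewrite -uT.
  by rewrite uT b0.
have comm u v : u \in powset A 2 -> v \in powset A 2 -> (u * v = v * u)%g.
  move=> uH vH; have : (u * v * (u^-1 * v^-1) = 1)%g.
    apply: slope1; first by rewrite !mulH ?invH.
    rewrite !slopeM !slopeV -invfM mulfV // mulf_neq0 //; exact: slope_neq0.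
  by rewrite -invgM => /eqP; rewrite mulg_eq1 invgK => /eqP.
have [g gA [h hA gh]] : exists2 g, g \in A & exists2 h, h \in A & g != h.
  have /fset0Pn[g gA] : A != fset0 by rewrite -cardfs_gt0; apply: ltnW.
  have : A `\ g != fset0 by rewrite -cardfs_gt0; move: A2; rewrite (cardfsD1 g) gA.
  by case/fset0Pn => h; rewrite !inE eq_sym => /andP[hg hA]; exists g => //; exists h.
pose u := (g^-1 * h)%g.
have uH : u \in powset A 2 by rewrite mem2 // symset_inv.
have u1 : slope u != 1.
  by apply: contraNneq gh => /(slope1 _ uH)/mulg1_eq; rewrite invgK => ->.
pose x := intercept u / (1 - slope u).
have u10 : 1 - slope u != 0 by rewrite subr_eq0 eq_sym.
have ux : aff_app u x = x.
  by rewrite /aff_app /x; field.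
have fixx v : v \in powset A 2 -> aff_app v x = x.
  move=> vH; apply/eqP; apply: contraNT u1 => vx; apply/eqP.
  suff -> : u = 1%g by [].
  apply: (aff_eq_app2 vx); rewrite aff_app1 //.
  by rewrite -aff_app_mul comm // aff_app_mul ux.
have [k kA] := spread x (aff_app g^-1%g x); case/eqP.
by apply: (@aff_app_inj _ g); rewrite -!aff_app_mul mulgV aff_app1 fixx // mem2.
Qed.

(** Since A^2 is a subgroup it contains the powers of the translation. *)
Lemma translation_mulrn (F : fieldType) (A : {fset aff F}) b k :
  symset A -> (2 <= #|` A|)%N -> (2 * #|` powset A 2| < 3 * #|` A|)%N ->
  translation b \in powset A 2 -> translation (b *+ k) \in powset A 2.
Proof.
move=> AV A2 small bH; elim: k => [|k IHk]; last first.
  by rewrite mulrS -translationD powset2_closed.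
have -> : translation 0 = (translation b * (translation b)^-1)%g by rewrite mulgV.
by rewrite powset2_closed // powset_inv.
Qed.

(** * The k lowest elements of a finite strict order *)

Section LowestElements.
Variables (T : finType) (r : rel T).
Hypothesis r_irr : irreflexive r.
Hypothesis r_trans : transitive r.
Hypothesis r_total : forall i j, i != j -> r i j || r j i.

Definition rank (i : T) : nat := #|[set j | r j i]|.
Definition lowest (k : nat) : {set T} := [set i | rank i < k]%N.

Lemma rank_lt i j : r i j -> (rank i < rank j)%N.
Proof.
move=> rij; apply: proper_card; apply/properP; split.
  by apply/fintype.subsetP => l; rewrite !inE => /r_trans; apply.
by exists i; rewrite !inE ?r_irr.
Qed.

Lemma lowest_sep k i j : i \in lowest k -> j \notin lowest k -> r i j.
Proof.
rewrite !inE -leqNgt => ik jk; have ij : i != j.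
  by apply: contraTneq ik => ->; rewrite -leqNgt.
have [//|/rank_lt ji] := orP (r_total ij).
by have := ltn_trans (leq_ltn_trans jk ji) ik; rewrite ltnn.
Qed.

Lemma card_lowest k : (k <= #|T|)%N -> #|lowest k| = k.
Proof.
move=> kT.
have rank_bound i : (rank i < #|T|)%N.
  rewrite -cardsT; apply: proper_card; apply/properP; split=> //.
  by exists i; rewrite !inE ?r_irr.
pose f i := Ordinal (rank_bound i).
have f_inj : injective f.
  move=> i j /(congr1 val) /= eq_rank; apply: contraTeq isT => /r_total.
  by case/orP => /rank_lt; rewrite eq_rank ltnn.
have f_bij : bijective f by apply: inj_card_bij; rewrite ?card_ord.
have -> : lowest k = f @^-1: [set widen_ord kT m | m in 'I_k].
  apply/setP => i; rewrite !inE; apply/idP/imsetP => [ik|[m _ /(congr1 val) /= ->]].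
    by exists (Ordinal ik) => //; apply: val_inj.
  exact: ltn_ord.
rewrite on_card_preimset; last exact: onW_bij.
by rewrite card_imset ?card_ord // => m l /(congr1 val) /= ?; apply: val_inj.
Qed.

End LowestElements.

(** The staircase argument: in the grid of the values X p q, walk along the row
    of the smallest q and then up the column of the largest p.  The values
    increase strictly all the way, and there are |P| + |Q| - 1 of them. *)
Lemma card_monotone_grid (R : realDomainType) (T : finType) (P Q : {set T})
    (p0 q0 : T) (s : T -> R) (X : T -> T -> R) (V : seq R) :
  p0 \in P -> q0 \in Q -> injective s ->
  (forall p p' q, p \in P -> p' \in P -> q \in Q -> s p < s p' -> X p q < X p' q) ->
  (forall p q q', p \in P -> q \in Q -> q' \in Q -> s q < s q' -> X p q < X p q') ->
  (forall p q, p \in P -> q \in Q -> X p q \in V) ->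
  (#|P| + #|Q| <= (size V).+1)%N.
Proof.
move=> p0P q0Q s_inj Xp Xq XV.
have mono_inj (A : {set T}) (f : T -> R) :
    (forall i j, i \in A -> j \in A -> s i < s j -> f i < f j) ->
    {in A &, injective f}.
  move=> f_mono i j iA jA eqf; apply: contra_eq eqf => ij.
  have : s i != s j by apply: contra_neq ij => /s_inj.
  by rewrite neq_lt => /orP[] /f_mono lt; [rewrite lt_eqF ?lt|rewrite gt_eqF ?lt].
have [p1 p1P p1max] : exists2 p1, p1 \in P & forall p, p \in P -> s p <= s p1.
  by case: (Order.TotalTheory.arg_maxP s p0P) => p1; exists p1.
have [q1 q1Q q1min] : exists2 q1, q1 \in Q & forall q, q \in Q -> s q1 <= s q.
  by case: (Order.TotalTheory.arg_minP s q0Q) => q1; exists q1.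
rewrite (cardsD1 q1 Q) q1Q addnCA addnC addn1 ltnS !cardE.
rewrite -(size_map (X^~ q1) (enum P)) -(size_map (X p1)) -size_cat.
have Q1Q q : q \in Q :\ q1 -> q \in Q by rewrite !inE => /andP[].
apply: uniq_leq_size => [|v]; last first.
  rewrite mem_cat => /orP[] /mapP[i]; rewrite mem_enum => iA ->.
    exact: XV.
  by apply: XV => //; apply: Q1Q.
rewrite cat_uniq !map_inj_in_uniq ?enum_uniq; first last.
- move=> p p' /[!mem_enum]; apply: (mono_inj P (X^~ q1)) => i j iP jP; exact: Xp.
- move=> q q' /[!mem_enum]; apply: (mono_inj _ (X p1)) => i j /Q1Q iQ /Q1Q jQ; exact: Xq.
rewrite andbT /=; apply/hasPn => _ /mapP[q /[!mem_enum] qQ ->].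
apply/mapP => -[p /[!mem_enum] pP eqX].
have : X p1 q1 < X p1 q.
  apply: Xq => //; first exact: Q1Q.
  rewrite lt_neqAle q1min ?Q1Q // andbT.
  by apply: contraTneq qQ => /s_inj <-; rewrite !inE eqxx.
rewrite eqX ltNge; case/negP; have := p1max p pP; rewrite le_eqVlt.
by case/orP => [/eqP/s_inj -> //|/Xp lt]; apply/ltW/lt.
Qed.

(** Let d be supported on f = m_1 < ... < m_s = l with s >= 2.  Adding up the
    gap inequalities for consecutive m_i gives 2 S - d f - d l <= l - f, where
    S is the sum of d, and d f + d l <= S; hence S <= l - f < N. *)
Lemma spaced_sum (d : nat -> nat) (N i0 i1 : nat) :
  (forall i j, (i < j)%N -> (j < N)%N -> (0 < d i)%N -> (0 < d j)%N ->
     (forall m, (i < m)%N -> (m < j)%N -> d m = 0) -> (d i + d j <= j - i)%N) ->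
  (i0 < i1)%N -> (i1 < N)%N -> (0 < d i0)%N -> (0 < d i1)%N ->
  (\sum_(0 <= m < N) d m < N)%N.
Proof.
move=> gap i01 i1N di0 di1.
have scan M : (M <= N)%N ->
    (forall m, (m < M)%N -> d m = 0) \/
    exists f l, [/\ (f <= l)%N, (l < M)%N, (0 < d f)%N & (0 < d l)%N] /\
      [/\ forall m, (m < f)%N -> d m = 0,
          forall m, (l < m)%N -> (m < M)%N -> d m = 0,
          (2 * \sum_(0 <= m < M) d m <= l - f + d f + d l)%N,
          f = l -> (\sum_(0 <= m < M) d m = d f)%N
        & (f < l)%N -> (d f + d l <= \sum_(0 <= m < M) d m)%N].
  (* f and l are the first and last points of the support below M. *)
  elim: M => [|M IHM] MN; first by left.
  have [dM|dM] := posnP (d M).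
    case: (IHM (ltnW MN)) => [zero|[f [l [[fl lM df dl] [zf zl sum eqs lts]]]]].
      by left=> m; rewrite ltnS leq_eqVlt => /predU1P[-> //|]; apply: zero.
    right; exists f, l; split; split=> //; try lia.
    - by move=> m lm; rewrite ltnS leq_eqVlt => /predU1P[-> //|]; apply: zl.
    - by rewrite big_nat_recr //= dM addn0.
    - by rewrite big_nat_recr //= dM addn0.
    - by rewrite big_nat_recr //= dM addn0.
  right; case: (IHM (ltnW MN)) => [zero|[f [l [[fl lM df dl] [zf zl sum eqs lts]]]]].
    have sum0 : (\sum_(0 <= m < M) d m = 0)%N.
      by rewrite big_nat big1 // => m /andP[_]; apply: zero.
    exists M, M; split; split=> //; try lia.
    - by rewrite big_nat_recr //= sum0; lia.
    - by rewrite big_nat_recr //= sum0.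
  have := gap l M lM MN dl dM zl; rewrite !big_nat_recr //= => gapl.
  have df_sum : (d f <= \sum_(0 <= m < M) d m)%N.
    by move: fl; rewrite leq_eqVlt => /predU1P[/eqs ->|/lts]; lia.
  move: (\sum_(0 <= m < M) d m)%N sum df_sum => S sum df_sum.
  exists f, M; split; split=> //; lia.
case: (scan N (leqnn N)) => [zero|[f [l [[fl lN df dl] [zf zl sum eqs lts]]]]].
  by rewrite zero in di1.
have fi0 : (f <= i0)%N by rewrite leqNgt; apply/negP => /zf; lia.
have i1l : (i1 <= l)%N by rewrite leqNgt; apply/negP => /zl /(_ i1N); lia.
have := lts (leq_trans (leq_ltn_trans fi0 i01) i1l); lia.
Qed.

Lemma ltr_of_eq_mul (R : realFieldType) (s s' z z' : R) :
  0 < s' -> s' < s -> 0 < z' -> s * z = s' * z' -> z < z'.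
Proof. by move=> s'0 s's z'0 eqsz; rewrite ltNge; apply/negP => z'z; nra. Qed.

(** * Sweeping a vertical line across an arrangement of real lines *)

Section Pencils.
Variables (R : realFieldType) (T : finType) (a b : T -> R).
Hypothesis a_inj : injective a.

Definition line (i : T) (x : R) : R := a i * x + b i.
(** The abscissa at which the lines i and j meet. *)
Definition cross (i j : T) : R := (b j - b i) / (a i - a j).
Definition abscissae : seq R :=
  sort <=%R (undup [seq cross p.1 p.2 | p <- enum {: T * T} & p.1 != p.2]).

Lemma lineB i j x : i != j -> line i x - line j x = (a i - a j) * (x - cross i j).
Proof.
move=> ij; have : a i - a j != 0 by rewrite subr_eq0; apply: contra_neq ij => /a_inj.
by move=> aij; rewrite /line /cross; field.
Qed.

Lemma cross_abscissae i j : i != j -> cross i j \in abscissae.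
Proof.
move=> ij; rewrite mem_sort mem_undup; apply/mapP; exists (i, j) => //.
by rewrite mem_filter ij mem_enum.
Qed.

Lemma abscissaeP x :
  x \in abscissae -> exists i j, i != j /\ line i x = line j x.
Proof.
rewrite mem_sort mem_undup => /mapP[[i j]]; rewrite mem_filter /= => /andP[ij _] ->.
by exists i, j; split=> //; apply/eqP; rewrite -subr_eq0 lineB // subrr mulr0.
Qed.

Lemma line_eq_cross i j x : i != j -> line i x = line j x -> x = cross i j.
Proof.
move=> ij /eqP; rewrite -subr_eq0 lineB // mulf_eq0 !subr_eq0.
by case/orP => [/eqP/a_inj eqij|/eqP //]; rewrite eqij eqxx in ij.
Qed.

Lemma line_eq2 i j x y :
  x != y -> line i x = line j x -> line i y = line j y -> i = j.
Proof.
move=> xy eqx eqy; apply: contraNeq xy => ij.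
by rewrite (line_eq_cross ij eqx) (line_eq_cross ij eqy).
Qed.

(** P is a pencil through (x, u) and Q a pencil through (y, v), and the
    sign of e says on which side of these points the lines of the other pencil
    pass.  The crossing of p in P with q in Q lies strictly between x and y.
    Its distance to x times e (a q - a p) is e times the height of (x, u) above
    q, which depends only on q, and likewise on the other side with y and p; so
    the crossings form a strictly monotone grid in e a p and e a q. *)
Lemma card_two_pencils (P Q : {set T}) (p0 q0 : T) (e x y u v : R) :
  e != 0 -> p0 \in P -> q0 \in Q -> x < y ->
  (forall p, p \in P -> line p x = u) -> (forall q, q \in Q -> line q y = v) ->
  (forall q, q \in Q -> 0 < e * (u - line q x)) ->
  (forall p, p \in P -> 0 < e * (v - line p y)) ->
  (#|P| + #|Q| <= (count (fun t => (x < t < y)%R) abscissae).+1)%N.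
Proof.
move=> e0 p0P q0Q xy Px Qy Qx Py.
rewrite -size_filter.
have pq p q : p \in P -> q \in Q -> p != q.
  by move=> pP qQ; apply/eqP => pq; have := Qx q qQ; rewrite -pq Px // subrr mulr0 ltxx.
have atx p q : p \in P -> q \in Q -> 0 < e * (a q - a p) * (cross p q - x).
  move=> pP qQ; have := Qx q qQ; rewrite -(Px p pP) lineB ?pq //; congr (_ < _); ring.
have aty p q : p \in P -> q \in Q -> 0 < e * (a q - a p) * (y - cross p q).
  move=> pP qQ; have := Py p pP; rewrite -(Qy q qQ) -opprB lineB ?pq //.
  by congr (_ < _); ring.
have slope_lt p q : p \in P -> q \in Q -> 0 < e * (a q - a p).
  move=> pP qQ; have := addr_gt0 (atx p q pP qQ) (aty p q pP qQ).
  by rewrite -mulrDr [_ + (y - _)]addrC addrA subrK pmulr_lgt0 ?subr_gt0.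
have between p q : p \in P -> q \in Q -> x < cross p q < y.
  move=> pP qQ; have lt0 := slope_lt _ _ pP qQ.
  have := atx p q pP qQ; rewrite pmulr_rgt0 // subr_gt0 => ->.
  by have := aty p q pP qQ; rewrite pmulr_rgt0 // subr_gt0 => ->.
have fixp p q : p \in P -> q \in Q ->
    e * (a q - a p) * (cross p q - x) = e * (u - line q x).
  by move=> pP qQ; rewrite -(Px p pP) lineB ?pq //; ring.
have fixq p q : p \in P -> q \in Q ->
    e * (a q - a p) * (y - cross p q) = e * (v - line p y).
  by move=> pP qQ; rewrite -(Qy q qQ) -[_ - line p y]opprB lineB ?pq //; ring.
apply: (@card_monotone_grid _ _ P Q p0 q0 (fun i => e * a i) cross) => //.
- by move=> i j /(mulfI e0)/a_inj.
- move=> p p' q pP p'P qQ lt.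
  rewrite -(ltrD2r (- x)); apply: (ltr_of_eq_mul (s := e * (a q - a p)) (slope_lt p' q p'P qQ)).
  + by rewrite !mulrBr ltrD2l ltrN2.
  + by rewrite subr_gt0; case/andP: (between p' q p'P qQ).
  + by rewrite !fixp.
- move=> p q q' pP qQ q'Q lt.
  rewrite -ltrN2 -(ltrD2l y).
  apply: (ltr_of_eq_mul (s := e * (a q' - a p)) (slope_lt p q pP qQ)).
  + by rewrite !mulrBr ltrD2r.
  + by rewrite subr_gt0; case/andP: (between p q pP qQ).
  + by rewrite !fixq.
- by move=> p q pP qQ; rewrite mem_filter between // cross_abscissae // pq.
Qed.

(** The lines are compared by their height u, and ties are broken by c.  With
    ties broken by slope, [before x] and [after x] are the vertical orders of
    the lines just to the left and just to the right of x. *)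
Definition precedes (c u : T -> R) (i j : T) : bool :=
  (u i < u j) || ((u i == u j) && (c i < c j)).
Definition before (x : R) : rel T := precedes (fun i => - a i) (fun i => line i x).
Definition after (x : R) : rel T := precedes a (fun i => line i x).

Lemma precedes_irr c u : irreflexive (precedes c u).
Proof. by move=> i; rewrite /precedes !ltxx andbF. Qed.

Lemma precedes_trans c u : transitive (precedes c u).
Proof.
move=> j i l /orP[ij|/andP[/eqP ij cij]] /orP[jl|/andP[/eqP jl cjl]].
- by rewrite /precedes (lt_trans ij).
- by rewrite /precedes -jl ij.
- by rewrite /precedes ij jl.
- by rewrite /precedes ij jl eqxx (lt_trans cij) ?orbT.
Qed.

Lemma precedes_total c u : injective c ->
  forall i j, i != j -> precedes c u i j || precedes c u j i.
Proof.
move=> c_inj i j ij; rewrite /precedes.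
have : c i != c j by apply: contra_neq ij => /c_inj.
by case: (ltgtP (u i) (u j)) => //= _; rewrite neq_lt => ->.
Qed.

Lemma precedes_le c u i j : precedes c u i j -> u i <= u j.
Proof. by case/orP => [/ltW //|/andP[/eqP ->]]. Qed.

Let a_opp_inj : injective (fun i => - a i).
Proof. by move=> i j /oppr_inj/a_inj. Qed.

Lemma before_le x i j : before x i j -> line i x <= line j x.
Proof. exact: (precedes_le (u := line^~ x)). Qed.

Lemma after_le x i j : after x i j -> line i x <= line j x.
Proof. exact: (precedes_le (u := line^~ x)). Qed.

Lemma before_lt x i j : i != j -> x <= cross i j -> before x i j = (a j < a i).
Proof.
move=> ij xc; rewrite /before /precedes.
have aij : a i != a j by apply: contra_neq ij => /a_inj.
rewrite ltrN2 -[line i x < _]subr_lt0 -[_ == _]subr_eq0 lineB // mulf_eq0 subr_eq0 (negPf aij) /=.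
rewrite subr_eq0; move: xc; rewrite le_eqVlt => /predU1P[xc|xc].
  by rewrite xc subrr mulr0 ltxx eqxx.
by rewrite nmulr_llt0 ?subr_lt0 // subr_gt0 lt_eqF //= orbF.
Qed.

Lemma before_gt x i j : i != j -> cross i j < x -> before x i j = (a i < a j).
Proof.
move=> ij cx; rewrite /before /precedes.
have aij : a i != a j by apply: contra_neq ij => /a_inj.
rewrite -[line i x < _]subr_lt0 -[_ == _]subr_eq0 lineB // mulf_eq0 subr_eq0 (negPf aij) /=.
by rewrite subr_eq0 pmulr_llt0 ?subr_gt0 // subr_lt0 gt_eqF //= orbF.
Qed.

Lemma after_lt x i j : i != j -> x < cross i j -> after x i j = (a j < a i).
Proof.
move=> ij xc; rewrite /after /precedes.
have aij : a i != a j by apply: contra_neq ij => /a_inj.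
rewrite -[line i x < _]subr_lt0 -[_ == _]subr_eq0 lineB // mulf_eq0 subr_eq0 (negPf aij) /=.
by rewrite subr_eq0 nmulr_llt0 ?subr_lt0 // subr_gt0 lt_eqF //= orbF.
Qed.

Lemma after_gt x i j : i != j -> cross i j <= x -> after x i j = (a i < a j).
Proof.
move=> ij cx; rewrite /after /precedes.
have aij : a i != a j by apply: contra_neq ij => /a_inj.
rewrite -[line i x < _]subr_lt0 -[_ == _]subr_eq0 lineB // mulf_eq0 subr_eq0 (negPf aij) /=.
rewrite subr_eq0; move: cx; rewrite le_eqVlt => /predU1P[cx|cx].
  by rewrite cx subrr mulr0 ltxx eqxx.
by rewrite pmulr_llt0 ?subr_gt0 // subr_lt0 gt_eqF //= orbF.
Qed.

Lemma after_before x y :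
  x < y -> (forall t, t \in abscissae -> ~~ (x < t < y)) ->
  forall i j, after x i j = before y i j.
Proof.
move=> xy none i j; have [->|ij] := eqVneq i j.
  by rewrite /before /after !precedes_irr.
have := none _ (cross_abscissae ij).
have [cx _|xc /= yc] := leP (cross i j) x.
  by rewrite after_gt // before_gt // (le_lt_trans cx).
by rewrite after_lt // before_lt // leNgt.
Qed.

Variable k : nat.
Hypothesis k_le : (k <= #|T|)%N.

Definition low_before (x : R) : {set T} := lowest (before x) k.
Definition low_after (x : R) : {set T} := lowest (after x) k.

Lemma card_low_before x : #|low_before x| = k.
Proof.
apply: card_lowest => //; [exact: precedes_irr|exact: precedes_trans|].
exact: precedes_total.
Qed.

Lemma card_low_after x : #|low_after x| = k.
Proof.
apply: card_lowest => //; [exact: precedes_irr|exact: precedes_trans|].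
exact: precedes_total.
Qed.

Lemma low_before_sep x i j : i \in low_before x -> j \notin low_before x -> before x i j.
Proof. by apply: lowest_sep; [exact: precedes_irr|exact: precedes_trans|exact: precedes_total]. Qed.

Lemma low_after_sep x i j : i \in low_after x -> j \notin low_after x -> after x i j.
Proof. by apply: lowest_sep; [exact: precedes_irr|exact: precedes_trans|exact: precedes_total]. Qed.

Lemma low_after_before x y :
  x < y -> (forall t, t \in abscissae -> ~~ (x < t < y)) ->
  low_after x = low_before y.
Proof.
move=> xy none; apply/setP => i; rewrite !inE /rank.
by under eq_finset => j do rewrite (after_before xy none).
Qed.

(** The number of lines that enter the k lowest ones when the sweep crosses x.
    As many leave ([exchangeC]). *)
Definition exchange (x : R) : nat := #|low_after x :\: low_before x|.

Lemma exchangeC x : #|low_before x :\: low_after x| = exchange x.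
Proof. by rewrite /exchange !cardsD card_low_after card_low_before finset.setIC. Qed.

Lemma exchange0 x : exchange x = 0 -> low_after x = low_before x.
Proof.
move/eqP; rewrite cards_eq0 finset.setD_eq0 => sub.
by apply/eqP; rewrite eqEcard sub card_low_after card_low_before leqnn.
Qed.

(** A line that enters and a line that leaves are each not above the other at
    x, so they meet there; u is the height of the k-th lowest line at x, and
    all lines that are exchanged pass through (x, u). *)
Lemma exchange_pencil x : (0 < exchange x)%N ->
  exists u, [/\ forall i, i \in low_after x -> line i x <= u,
    forall i, i \in low_before x -> line i x <= u,
    forall i, i \notin low_after x -> u <= line i x,
    forall i, i \notin low_before x -> u <= line i x &
    forall i, (i \in low_after x) != (i \in low_before x) -> line i x = u].
Proof.
move=> d; have /card_gt0P[i iP] := d; have := d; rewrite -exchangeC => /card_gt0P[j jP].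
have [ia inb] := finset.setDP iP; have [jb jna] := finset.setDP jP.
have ij : line i x = line j x.
  apply/eqP; rewrite eq_le; apply/andP; split.
    exact: (after_le (low_after_sep ia jna)).
  exact: (before_le (low_before_sep jb inb)).
have la_le l : l \in low_after x -> line l x <= line i x.
  by move=> la; rewrite ij; exact: (after_le (low_after_sep la jna)).
have lb_le l : l \in low_before x -> line l x <= line i x.
  by move=> lb; exact: (before_le (low_before_sep lb inb)).
have la_ge l : l \notin low_after x -> line i x <= line l x.
  by move=> la; exact: (after_le (low_after_sep ia la)).
have lb_ge l : l \notin low_before x -> line i x <= line l x.
  by move=> lb; rewrite ij; exact: (before_le (low_before_sep jb lb)).
exists (line i x); split=> // l.
case: (boolP (l \in low_after x)) => la; case: (boolP (l \in low_before x)) => lb // _.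
  by apply: le_anti; rewrite la_le // lb_ge.
by apply: le_anti; rewrite lb_le // la_ge.
Qed.

Lemma card_one_sided_pencils (e x y u v : R) (S P Q : {set T}) :
  e != 0 -> x < y -> P \subset S -> Q \subset S -> (0 < #|P|)%N -> (0 < #|Q|)%N ->
  (forall l, l \in S -> 0 <= e * (u - line l x)) ->
  (forall l, l \in S -> 0 <= e * (v - line l y)) ->
  (forall l, l \in P -> line l x = u) -> (forall l, l \in Q -> line l y = v) ->
  (forall l, l \in S -> line l x = u -> line l y <> v) ->
  (#|P| + #|Q| <= (count (fun t => (x < t < y)%R) abscissae).+1)%N.
Proof.
move=> e0 xy /fintype.subsetP PS /fintype.subsetP QS.
move=> /card_gt0P[p pP] /card_gt0P[q qQ] Sx Sy Pu Qv not_both.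
apply: (@card_two_pencils P Q p q e x y u v) => // l lA.
- rewrite lt_neqAle Sx ?QS // andbT eq_sym mulf_neq0 // subr_eq0.
  by apply/eqP => ul; apply: (not_both l); rewrite ?QS ?Qv.
- rewrite lt_neqAle Sy ?PS // andbT eq_sym mulf_neq0 // subr_eq0.
  by apply/eqP => vl; apply: (not_both l); rewrite ?PS ?Pu.
Qed.

(** Between two consecutive exchanges, at x and at y, the set of the k lowest
    lines does not change.  The lines that enter it at x and those that leave
    it at y are two pencils on which [card_two_pencils] gives the bound, unless
    one of the k lowest lines passes through both centres.  In that case no
    other line does, and the bound comes from two pencils of the lines above:
    those that leave the set at x and those that enter it at y. *)
Lemma exchange_gap x y :
  x < y -> low_after x = low_before y -> (0 < exchange x)%N -> (0 < exchange y)%N ->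
  (exchange x + exchange y <= (count (fun t => (x < t < y)%R) abscissae).+1)%N.
Proof.
move=> xy L dx dy.
have [u [xa _ xna _ xu]] := exchange_pencil dx.
have [v [_ yb _ ynb yv]] := exchange_pencil dy.
have uniq_both l m : line l x = u -> line l y = v -> line m x = u -> line m y = v -> l = m.
  by move=> lu lv mu mv; apply: (@line_eq2 l m x y); rewrite ?lt_eqF // ?lu ?lv.
case: (boolP [exists l in low_after x, (line l x == u) && (line l y == v)]).
- case/existsP => l /and3P[la /eqP lu /eqP lv].
  rewrite -exchangeC.
  apply: (@card_one_sided_pencils (- 1) x y u v (~: low_after x)) => //.
  + by rewrite finset.setDE finset.subsetIr.
  + by rewrite L finset.setDE finset.subsetIr.
  + by rewrite exchangeC.
  + by move=> m; rewrite finset.in_setC => ma; rewrite mulN1r opprB subr_ge0 xna.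
  + by move=> m; rewrite finset.in_setC L => mb; rewrite mulN1r opprB subr_ge0 ynb.
  + by move=> m /finset.setDP[mi mo]; rewrite xu // mi (negPf mo).
  + by move=> m /finset.setDP[mi mo]; rewrite yv // mi (negPf mo).
  + move=> m; rewrite finset.in_setC => /negP ma mu mv; apply: ma.
    by rewrite -(uniq_both l m).
- rewrite negb_exists => /forallP none.
  rewrite -(exchangeC y).
  apply: (@card_one_sided_pencils 1 x y u v (low_after x)) => //.
  + exact: finset.subsetDl.
  + by rewrite L; exact: finset.subsetDl.
  + by rewrite exchangeC.
  + by move=> m ma; rewrite mul1r subr_ge0 xa.
  + by move=> m; rewrite L => mb; rewrite mul1r subr_ge0 yb.
  + by move=> m /finset.setDP[mi mo]; rewrite xu // mi (negPf mo).
  + by move=> m /finset.setDP[mi mo]; rewrite yv // mi (negPf mo).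
  + move=> m ma mu mv; have := none m; rewrite ma mu mv !eqxx //.
Qed.

Let N : nat := size abscissae.
Let pt (m : nat) : R := nth 0 abscissae m.

Lemma abscissae_sorted : sorted <%R abscissae.
Proof. by rewrite sort_lt_sorted undup_uniq. Qed.

Lemma pt_lt i j : (i < j)%N -> (j < N)%N -> pt i < pt j.
Proof.
move=> ij jN; rewrite /pt (lt_sorted_ltn_nth 0 abscissae_sorted) //.
by rewrite inE (ltn_trans ij).
Qed.

Lemma abscissae_between t i j : (i < j)%N -> (j < N)%N -> t \in abscissae ->
  pt i < t < pt j -> exists2 m, (i < m < j)%N & t = pt m.
Proof.
move=> ij jN tX; have mN : (index t abscissae < N)%N by rewrite index_mem.
rewrite -[t](nth_index 0 tX) !(lt_sorted_ltn_nth 0 abscissae_sorted) ?inE //.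
  by exists (index t abscissae).
exact: ltn_trans jN.
Qed.

Lemma count_between i j : (i < j)%N -> (j < N)%N ->
  ((count (fun t => (pt i < t < pt j)%R) abscissae).+1 <= j - i)%N.
Proof.
move=> ij jN; rewrite -size_filter.
have -> : (j - i = (size (iota i.+1 (j - i.+1))).+1)%N by rewrite size_iota subnSK.
rewrite ltnS -(size_map pt); apply: uniq_leq_size.
  by rewrite filter_uniq // lt_sorted_uniq // abscissae_sorted.
move=> t; rewrite mem_filter => /andP[tij tX].
have [m /andP[im mj] ->] := abscissae_between ij jN tX tij.
by apply: map_f; rewrite mem_iota im subnKC.
Qed.

Lemma low_after_step i : (i.+1 < N)%N -> low_after (pt i) = low_before (pt i.+1).
Proof.
move=> iN; apply: low_after_before => [|t tX]; first exact: pt_lt.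
apply/negP => ht; have [m] := abscissae_between (ltnSn i) iN tX ht.
by rewrite ltnS => /andP[im mi]; move: (leq_trans im mi); rewrite ltnn.
Qed.

Lemma low_after_steps i j : (i < j)%N -> (j < N)%N ->
  (forall m, (i < m)%N -> (m < j)%N -> exchange (pt m) = 0%N) ->
  low_after (pt i) = low_before (pt j).
Proof.
elim: j => [//|j IHj] ij jN zero; move: ij; rewrite ltnS leq_eqVlt => /predU1P[->|ij].
  exact: low_after_step.
rewrite IHj ?(ltnW jN) // => [|m im mj]; last by apply: zero; rewrite // ltnW.
by rewrite -low_after_step // exchange0 // zero.
Qed.

(** A line that ends among the k lowest without having started there entered
    at some abscissa. *)
Lemma leq_sum_exchange M : (M < N)%N ->
  (#|low_after (pt M) :\: low_before (pt 0)|
     <= \sum_(0 <= m < M.+1) exchange (pt m))%N.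
Proof.
elim: M => [|M IHM] MN; first by rewrite big_nat1.
rewrite big_nat_recr //=; apply: leq_trans (leq_add (IHM (ltnW MN)) (leqnn _)).
rewrite (low_after_step MN) addnC.
apply: leq_trans (leq_card_setU _ _); apply: subset_leq_card.
apply/fintype.subsetP => l; rewrite !(finset.in_setU, finset.in_setD).
by case: (l \in low_after _); case: (l \in low_before (pt 0));
  case: (l \in low_before _).
Qed.

Lemma exchange_indices_gap i j : (i < j)%N -> (j < N)%N ->
  (0 < exchange (pt i))%N -> (0 < exchange (pt j))%N ->
  (forall m, (i < m)%N -> (m < j)%N -> exchange (pt m) = 0%N) ->
  (exchange (pt i) + exchange (pt j) <= j - i)%N.
Proof.
move=> ij jN di dj zero; apply: leq_trans (count_between ij jN).
by apply: exchange_gap => //; [exact: pt_lt|exact: low_after_steps].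
Qed.
End Pencils.

(** Take k to be half the number of lines.  Far to the left the k lowest lines
    are the k steepest ones, far to the right the k flattest ones, and these
    are disjoint; so the exchanges add up to at least k.  If there are at least
    two of them, [spaced_sum] concludes.  If there is only one, then 2 k lines
    pass through one point (x, u), and a line l that misses this point meets
    them at 2 k distinct abscissae. *)
Lemma card_abscissae (R : realFieldType) (T : finType) (a b : T -> R) :
  injective a -> (1 < #|T|)%N ->
  (forall x y, exists i, line a b i x != y) ->
  (#|T|./2 < size (abscissae a b))%N.
Proof.
move=> a_inj T2 spread; set k := #|T|./2; set N := size _.
have k_le : (k <= #|T|)%N by rewrite leq_half_double; lia.
have kk : (k.*2 <= #|T|)%N by rewrite -(odd_double_half #|T|) leq_addl.
have k0 : (0 < k)%N by rewrite half_gt0.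
pose pt m : R := nth 0 (abscissae a b) m.
pose d m := exchange a b k (pt m).
have N0 : (0 < N)%N.
  have /card_gt1P[i [j [_ _ ij]]] : (1 < #|T|)%N by [].
  by have := cross_abscissae a b ij; rewrite /N; case: (abscissae a b).
have first_le t : t \in abscissae a b -> pt 0 <= t.
  move=> tX; rewrite -(nth_index 0 tX) -/(pt _).
  have [-> //|i0] := posnP (index t (abscissae a b)).
  by apply/ltW/pt_lt => //; rewrite index_mem.
have last_ge t : t \in abscissae a b -> t <= pt N.-1.
  move=> tX; rewrite -(nth_index 0 tX) -/(pt _).
  have : (index t (abscissae a b) <= N.-1)%N by rewrite -ltnS prednK // index_mem.
  rewrite leq_eqVlt => /predU1P[-> //|lt]; apply/ltW/pt_lt => //.
  by rewrite -/N prednK.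
(* A line in both sets has fewer than k lines flatter and fewer than k lines
   steeper than itself, which leaves fewer than 2 k lines in all. *)
have disj i : i \in low_after a b k (pt N.-1) -> i \notin low_before a b k (pt 0).
  rewrite !inE /rank.
  have -> : [set j | after a b (pt N.-1) j i] = [set j | a j < a i].
    apply/setP => j; rewrite !inE; have [->|ij] := eqVneq j i.
      by rewrite ltxx; apply: precedes_irr.
    by rewrite after_gt // last_ge // cross_abscissae.
  have -> : [set j | before a b (pt 0) j i] = [set j | a i < a j].
    apply/setP => j; rewrite !inE; have [->|ij] := eqVneq j i.
      by rewrite ltxx; apply: precedes_irr.
    by rewrite before_lt // first_le // cross_abscissae.
  move=> lo; apply/negP => hi.
  have : (#|[set: T]| <= #|[set j | (a j < a i)%R] :|: [set j | (a i < a j)%R]| + #|[set i]|)%N.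
    apply: leq_trans (leq_card_setU _ _); apply: subset_leq_card.
    apply/fintype.subsetP => j _; rewrite !inE.
    by case: (ltgtP (a i) (a j)) => [||/a_inj ->]; rewrite ?orbT ?eqxx ?orbT.
  rewrite cardsT cards1 leqNgt => /negP; apply.
  apply: leq_trans kk; rewrite -addnn addn1; apply: leq_trans (leq_add lo hi).
  by rewrite addSn addnS !ltnS leq_card_setU.
have sum_ge : (k <= \sum_(0 <= m < N) d m)%N.
  have := @leq_sum_exchange _ _ a b a_inj k N.-1; rewrite prednK // => /(_ (leqnn _)).
  rewrite (_ : _ :\: _ = low_after a b k (pt N.-1)) ?card_low_after //.
  by apply/setP => i; rewrite finset.in_setD andbC; case: (boolP (i \in _)) => // /disj ->.
have [[i0 [i1 [i01 i1N d0 d1]]]|single] :=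
    pselect (exists i0 i1, [/\ (i0 < i1)%N, (i1 < N)%N, (0 < d i0)%N & (0 < d i1)%N]).
  apply: leq_ltn_trans sum_ge _; apply: (spaced_sum _ i01 i1N d0 d1) => i j.
  exact: exchange_indices_gap.
have [m mN dm] : exists2 m, (m < N)%N & (0 < d m)%N.
  apply: contrapT => /forall2NP none.
  suff sum0 : (\sum_(0 <= m < N) d m = 0)%N by rewrite sum0 leqNgt k0 in sum_ge.
  rewrite big_nat big1 // => i /andP[_ iN].
  by case: (none i) => [/negP|/negP]; rewrite ?iN // -eqn0Ngt => /eqP.
have k_dm : (k <= d m)%N.
  apply: leq_trans sum_ge _; rewrite big_mkord (bigD1 (Ordinal mN)) //=.
  rewrite big1 ?addn0 // => i im; apply/eqP; rewrite eqn0Ngt; apply/negP => di; apply: single.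
  have : (i : nat) != m by apply: contra_neq im => im; apply: val_inj.
  by rewrite neq_ltn => /orP[im'|mi]; [exists i, m|exists m, i].
have [u [_ _ _ _ through]] := exchange_pencil a_inj k_le dm.
have [l lu] := spread (pt m) u.
set La := low_after a b k (pt m) in through; set Lb := low_before a b k (pt m) in through.
pose P := (La :\: Lb) :|: (Lb :\: La).
have Pu i : i \in P -> line a b i (pt m) = u.
  move=> iP; apply: through; move: iP; rewrite !(finset.in_setU, finset.in_setD).
  by case: (i \in La); case: (i \in Lb).
have Pl i : i \in P -> i != l by move=> /Pu iu; apply: contra_neq lu => <-.
have cardP : #|P| = (d m + d m)%N.
  rewrite cardsU exchangeC // -/(exchange a b k (pt m)) -/(d m).
  rewrite (_ : _ :&: _ = finset.set0) ?cards0 ?subn0 //.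
  apply/setP => i; rewrite !(finset.in_setI, finset.in_setD, finset.in_set0).
  by case: (i \in La); case: (i \in Lb).
have : (#|P| <= N)%N; last lia.
rewrite cardE -(size_map (fun i => cross a b i l)); apply: uniq_leq_size.
  rewrite map_inj_in_uniq ?enum_uniq // => i j /[!mem_enum] iP jP eqc.
  pose t := cross a b i l.
  have meet h : h \in P -> t = cross a b h l -> line a b h t = line a b l t.
    by move=> hP ->; apply/subr0_eq; rewrite lineB ?Pl // subrr mulr0.
  apply: (@line_eq2 _ _ a b a_inj i j t (pt m)); rewrite ?Pu //.
    by apply: contra_neq lu => tm; rewrite -tm -(meet i) // tm Pu.
  by rewrite (meet i) // (meet j).
by move=> _ /mapP[i /[!mem_enum] iP ->]; rewrite cross_abscissae ?Pl.
Qed.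

Lemma exists_fresh (R : realDomainType) (s : seq R) : exists2 x, 0 < x & x \notin s.
Proof.
exists (1 + \sum_(y <- s) `|y|).
  by rewrite ltr_pwDl ?ltr01 // sumr_ge0.
apply/negP => xs; have := big_rem _ xs => /= E.
have : 1 + \sum_(y <- s) `|y| <= \sum_(y <- s) `|y|.
  rewrite {2}(E _ _ _ predT (fun y => `|y|)) /=.
  by apply: ler_wpDr; [rewrite sumr_ge0|exact: ler_norm].
by rewrite gerDr ler10.
Qed.

(** Distinct lines of A may be parallel.  The projective change of abscissa
    t |-> t / (1 + c t), with values multiplied by 1 + c t, turns the line with
    slope s and intercept b into the one with slope s + c b and intercept b,
    and it preserves coincidences of values.  A generic c makes these slopes
    distinct, and only the abscissa t = - 1 / c is lost, as it corresponds to
    the point at infinity. *)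
Lemma exists_many_secants_real (R : realFieldType) (A : {fset aff R}) :
  (exists g h, [/\ g \in A, h \in A & slope g != slope h]) ->
  (forall x y, exists2 g, g \in A & aff_app g x != y) ->
  exists2 D : {fset R}, forall x, x \in D -> secant A x & (#|` A| <= (2 * #|` D|).+1)%N.
Proof.
move=> [g0 [h0 [g0A h0A gh0]]] spread.
(* The values of c to avoid: those for which two lines become parallel. *)
pose ratio (p : A * A) := (slope (val p.2) - slope (val p.1)) / (intercept (val p.1) - intercept (val p.2)).
have [c c0 cfresh] := exists_fresh [seq ratio p | p <- enum {: A * A}].
pose a (i : A) := slope (val i) + c * intercept (val i).
pose b (i : A) := intercept (val i).
have a_inj : injective a.
  move=> i j eqa; have [eqb|neqb] := eqVneq (b i) (b j).
    apply/val_inj/aff_eqP => //; apply: (@addIr _ (c * b i)).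
    by rewrite [RHS]/= {2}eqb.
  case/negP: cfresh; apply/mapP; exists (i, j); first by rewrite mem_enum.
  have neq : intercept (val i) - intercept (val j) != 0 by rewrite subr_eq0.
  apply: (mulIf neq); rewrite /ratio /= divfK //.
  move: eqa; rewrite /a => eqa.
  lra.
have A2 : (1 < #|{: A}|)%N.
  apply/card_gt1P; exists [` g0A], [` h0A]; split=> //.
  by apply: contra_neq gh0 => /(congr1 val) /= ->.
have lineE i t : 1 + c * t != 0 ->
    line a b i t = (1 + c * t) * aff_app (val i) (t / (1 + c * t)).
  by move=> t0; rewrite /line /a /b /aff_app; field.
have spread' x y : exists i, line a b i x != y.
  (* At the lost abscissa the value is x times the original slope. *)
  have [t0|t0] := eqVneq (1 + c * x) 0.
    have [eqg|] := eqVneq (line a b [` g0A] x) y; last by exists [` g0A].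
    exists [` h0A]; apply: contra_neq gh0; rewrite -eqg /line /a /b /=.
    have x0 : x != 0 by apply: contra_eq_neq t0 => ->; rewrite mulr0 addr0 oner_eq0.
    have lineE0 s i : (s + c * i) * x + i = s * x + i * (1 + c * x) by ring.
    by rewrite !lineE0 t0 !mulr0 !addr0 => /(mulIf x0).
  have [g gA gx] := spread (x / (1 + c * x)) (y / (1 + c * x)).
  exists [` gA]; rewrite lineE //; apply: contra_neq gx => <-.
  by rewrite mulrAC mulfV // mul1r.
have := card_abscissae a_inj A2 spread'.
have -> : #|{: A}| = #|` A| by rewrite cardfE.
move=> size_gt.
pose s := [seq t <- abscissae a b | 1 + c * t != 0].
exists [fset t / (1 + c * t) | t in s].
  move=> _ /imfsetP[t /= ts ->]; have : t \in s := ts.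
  rewrite mem_filter => /andP[t0 /(abscissaeP a_inj)[i [j [ij eqt]]]].
  exists (val i), (val j); split; rewrite ?fsvalP //.
  by apply: (mulfI t0); rewrite -!lineE.
rewrite card_in_imfset /=; last first.
  move=> t u; rewrite !mem_filter => /andP[t0 _] /andP[u0 _] eqtu.
  have : t * (1 + c * u) = u * (1 + c * t).
    by rewrite -[t in LHS](divfK t0) eqtu mulrAC divfK // mulrC.
  by rewrite !mulrDr !mulr1 mulrCA [u * _]mulrCA [t * u]mulrC => /addIr.
have s_uniq : uniq s by rewrite filter_uniq // lt_sorted_uniq // abscissae_sorted.
rewrite undup_id //.
have : (size (abscissae a b) <= (size s).+1)%N.
  rewrite -(count_predC (fun t => 1 + c * t != 0) (abscissae a b)) -size_filter -addn1.
  rewrite leq_add2l (@eq_count _ _ (pred1 (- c^-1))) => [|t].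
    by rewrite count_uniq_mem ?leq_b1 // lt_sorted_uniq // abscissae_sorted.
  rewrite /= negbK; apply/eqP/eqP => [t0|->]; last by rewrite mulrN mulfV ?subrr ?lt0r_neq0.
  by apply: (mulfI (lt0r_neq0 c0)); rewrite mulrN mulfV ?lt0r_neq0 //; lra.
move: size_gt; rewrite -{2}(odd_double_half #|` A|) -muln2.
by move: #|` A|./2 (size s) (size _) => h n m; case: odd; lia.
Qed.

(** * Lacunary polynomials over finite fields *)

(** The derivative keeps all but one copy of each root, and the product over
    undup vs supplies one copy. *)
Lemma prod_XsubC_dvdp_deriv (F : fieldType) (vs : seq F) :
  \prod_(v <- vs) ('X - v%:P) %|
    \prod_(v <- undup vs) ('X - v%:P) * (\prod_(v <- vs) ('X - v%:P))^`().
Proof.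
elim: vs => [|v vs IHvs]; first by rewrite !big_nil mul1r dvd1p.
rewrite [undup _]/=; case: ifP => v_vs.
  rewrite !big_cons derivM derivXsubC mul1r mulrDr.
  apply: dvdp_add; last by rewrite mulrCA dvdp_mul2l ?polyXsubC_eq0.
  apply: dvdp_mul; last exact: dvdpp.
  by rewrite dvdp_XsubCl root_prod_XsubC mem_undup.
rewrite !big_cons derivM derivXsubC mul1r mulrDr; apply: dvdp_add.
  rewrite -mulrA; apply: dvdp_mul; first exact: dvdpp.
  exact: dvdp_mull.
rewrite mulrACA; apply: dvdp_mul; last exact: IHvs.
exact: dvdp_mull.
Qed.

Lemma prod_XsubC_dvdp_radical (F : fieldType) (vs : seq F) (P : {poly F}) :
  \prod_(v <- vs) ('X - v%:P) %| P ->
  \prod_(v <- vs) ('X - v%:P) %| \prod_(v <- undup vs) ('X - v%:P) * P^`().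
Proof.
case/dvdpP => Q ->; rewrite derivM mulrDr; apply: dvdp_add.
  by rewrite mulrA dvdp_mull.
by rewrite mulrCA dvdp_mull // prod_XsubC_dvdp_deriv.
Qed.

(** Polynomials in two variables are polynomials in X over F[Y]; the
    coefficient of X^m has degree at most d - m in Y. *)
Definition total_degree_le (F : fieldType) (d : nat) (P : {poly {poly F}}) : Prop :=
  forall m : nat, (size (P`_m)%R <= d.+1 - m)%N.

Lemma total_degree_leM (F : fieldType) d e (P Q : {poly {poly F}}) :
  total_degree_le d P -> total_degree_le e Q -> total_degree_le (d + e) (P * Q).
Proof.
move=> Pd Qe m; rewrite coefM; apply: (leq_trans (size_sum _ _ _)).
apply/bigmax_leqP => -[j jm] _ /=; have := Pd j; have := Qe (m - j)%N.
have [->|P0] := eqVneq P`_j 0; first by rewrite mul0r size_poly0.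
have [->|Q0] := eqVneq Q`_(m - j) 0; first by rewrite mulr0 size_poly0.
rewrite size_mul //; move: P0 Q0; rewrite -!size_poly_gt0.
by move: (size _) (size _) jm => s t; lia.
Qed.

Lemma total_degree_leB (F : fieldType) d (P Q : {poly {poly F}}) :
  total_degree_le d P -> total_degree_le d Q -> total_degree_le d (P - Q).
Proof.
move=> Pd Qd m; rewrite coefB (leq_trans (size_polyD _ _)) // size_polyN.
by rewrite geq_max Pd Qd.
Qed.

Lemma total_degree_le_polyC (F : fieldType) d (c : {poly F}) :
  (size c <= d.+1)%N -> total_degree_le d c%:P.
Proof.
by move=> cd [|m]; rewrite coefC //= size_poly0.
Qed.

Lemma total_degree_le_Xn (F : fieldType) k :
  total_degree_le k ('X^k : {poly {poly F}}).
Proof.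
move=> m; rewrite coefXn; have [->|_] := eqVneq m k; last by rewrite size_poly0.
by rewrite size_poly1 subSn ?subnn.
Qed.

Lemma total_degree_le_trans (F : fieldType) d e (P : {poly {poly F}}) :
  (d <= e)%N -> total_degree_le d P -> total_degree_le e P.
Proof. by move=> de Pd m; apply: leq_trans (Pd m) _; lia. Qed.

(** Each step of the long division by a monic divisor subtracts a multiple
    whose total degree does not exceed that of the dividend. *)
Lemma total_degree_le_division (F : fieldType) d n (D P : {poly {poly F}}) :
  D \is monic -> size D = n.+1 -> total_degree_le n D -> total_degree_le d P ->
  exists Q r, [/\ P = Q * D + r, (size r <= n)%N & total_degree_le d r].
Proof.
move=> Dm Dn Dd; have [s] := ubnP (size P); elim: s P => // s IHs P sP Pd.
have [Pn|Pn] := leqP (size P) n; first by exists 0, P; rewrite mul0r add0r.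
pose m := (size P).-1; pose c := P`_m.
have mS : size P = m.+1 by rewrite /m prednK // (leq_ltn_trans _ Pn).
have nm : (n <= m)%N by rewrite -ltnS -mS.
have c0 : c != 0 by rewrite -[c]/(lead_coef P) lead_coef_eq0 -size_poly_gt0 mS.
have md : (m <= d)%N.
  by have := Pd m; rewrite -/c; move: c0; rewrite -size_poly_gt0; lia.
pose S := c%:P * ('X^(m - n) * D).
have Sd : total_degree_le d S.
  have -> : d = (d - m + (m - n + n))%N by lia.
  apply: total_degree_leM.
    by apply: total_degree_le_polyC; have := Pd m; rewrite -/c; lia.
  by apply: total_degree_leM => //; exact: total_degree_le_Xn.
have sPS : (size (P - S)%R <= m)%N.
  apply/leq_sizeP => j mj; rewrite coefB /S coefCM coefXnM ltnNge.
  rewrite (leq_trans (leq_subr _ _) mj) /=.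
  move: mj; rewrite leq_eqVlt => /predU1P[<-|mj].
    rewrite subKn //; have := monicP Dm; rewrite lead_coefE Dn => -> /=.
    by rewrite mulr1 subrr.
  rewrite nth_default ?mS // [D`_ _]nth_default ?mulr0 ?subrr // Dn; lia.
have [|Q [r [PSE rn rd]]] := IHs (P - S) _ (total_degree_leB Pd Sd).
  by apply: leq_ltn_trans sPS _; rewrite -ltnS -mS.
exists (Q + c%:P * 'X^(m - n)), r; split=> //.
by rewrite mulrDl -mulrA -/S addrAC -PSE subrK.
Qed.

(** r is the remainder of X^q - X in the division by the product D of the
    factors X - (a_i Y + b_i).  If the n values a_i y + b_i are distinct, then
    D(X, y) divides X^q - X, so r(X, y) = 0.  Each coefficient r_m(Y) thus
    vanishes at q - |E| points, while its degree is at most q - m; so it is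
    zero for m > |E|. *)
Lemma rem_total_degree_lacunary (F : finFieldType) (T : finType) (a b : T -> F)
    (n := #|T|) (q := #|F|)
    (E := [set y | ~~ injectiveb (fun i => a i * y + b i)]) :
  exists r : {poly {poly F}}, (size r <= #|E|.+1)%N /\
    forall y, \prod_(v <- [seq a i * y + b i | i <- enum T]) ('X - v%:P)
      %| 'X^q - 'X - map_poly (horner_eval y) r.
Proof.
pose l i : {poly F} := (a i)%:P * 'X + (b i)%:P.
pose D : {poly {poly F}} := \prod_(i <- enum T) ('X - (l i)%:P).
have D_monic : D \is monic by apply: monic_prod => i _; exact: monicXsubC.
have D_size : size D = n.+1 by rewrite size_prod_XsubC -cardE.
have D_deg : total_degree_le n D.
  rewrite /D /n cardE; elim: (enum T) => [|i s IHs].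
    by rewrite big_nil -[1]/(1%:P); apply: total_degree_le_polyC; rewrite size_poly1.
  rewrite big_cons -[size _]/(1 + size s)%N; apply: total_degree_leM => //.
  apply: total_degree_leB; first by rewrite -[X in total_degree_le _ X]expr1; exact: total_degree_le_Xn.
  apply: total_degree_le_polyC; rewrite (leq_trans (size_polyD _ _)) // geq_max.
  by rewrite (leq_trans (size_polyMleq _ _)) ?size_polyC ?size_polyX; do 2?case: (_ != 0).
have P_deg : total_degree_le q ('X^q - 'X : {poly {poly F}}).
  apply: total_degree_leB; first exact: total_degree_le_Xn.
  apply: (@total_degree_le_trans _ 1); first exact: ltnW (finNzRing_gt1 F).
  by rewrite -[X in total_degree_le _ X]expr1; exact: total_degree_le_Xn.
have [Q [r [PE rn rd]]] := total_degree_le_division D_monic D_size D_deg P_deg.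
have DE y : map_poly (horner_eval y) D
    = \prod_(v <- [seq a i * y + b i | i <- enum T]) ('X - v%:P).
  rewrite /D rmorph_prod big_map; apply: eq_bigr => i _.
  by rewrite rmorphB /= map_polyX map_polyC /= /horner_eval /l !hornerE.
have ev y : 'X^q - 'X = map_poly (horner_eval y) Q * map_poly (horner_eval y) D
    + map_poly (horner_eval y) r.
  have := congr1 (map_poly (horner_eval y)) PE.
  by rewrite rmorphB /= map_polyXn map_polyX rmorphD rmorphM.
have Dr y : map_poly (horner_eval y) D %| 'X^q - 'X - map_poly (horner_eval y) r.
  by rewrite (ev y) addrK dvdp_mull.
exists r; split; last by move=> y; rewrite -DE.
apply/leq_sizeP => m Em; apply/eqP; apply: contraTT Em => rm0; rewrite -ltnNge.
have rm_root y : y \notin E -> root r`_m y.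
  rewrite inE negbK => /injectiveP inj; apply/rootP.
  suff r0 : map_poly (horner_eval y) r = 0.
    by rewrite -[_.[y]]/(horner_eval y r`_m) -coef_map r0 coef0.
  apply/eqP; apply: contraTT (leqnn n) => r0; rewrite -ltnNge.
  have : map_poly (horner_eval y) D %| map_poly (horner_eval y) r.
    have : map_poly (horner_eval y) D %| 'X^q - 'X.
      rewrite DE; apply: uniq_roots_dvdp.
        by apply/allP => v _; rewrite rootE !hornerE expf_card subrr.
      by rewrite uniq_rootsE map_inj_uniq ?enum_uniq.
    by move=> dvd; rewrite -[map_poly _ r](subKr ('X^q - 'X)) dvdp_sub.
  move/(dvdp_leq r0); rewrite DE size_prod_XsubC size_map -cardE => lt.
  apply: leq_trans lt _; apply: leq_trans (size_poly _ _) rn.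
have := max_poly_roots rm0 (rs := enum (~: E)); rewrite enum_uniq -cardE.
have -> : all (root r`_m) (enum (~: E)).
  by apply/allP => y; rewrite mem_enum finset.in_setC => /rm_root.
move=> /(_ isT isT); have := rd m; have := cardsC E; rewrite -/q.
by move: (size _) #|E| #|~: E| => s e f; lia.
Qed.

(** Take y in E, and let ry = r(X, y), of degree at most |E|.  The product of
    the X - v over the values v of the lines at y divides X^p - X - ry, whose
    derivative is - (1 + ry'); so it divides the product of its radical with
    1 + ry'.  The radical divides ry, because X^p - X vanishes on F_p.  Hence
    n <= deg ry + deg (1 + ry') <= 2 |E| - 1, unless one of the two factors is
    zero.  If ry = 0 the product divides its radical and y is not in E.  If
    ry' = -1, then ry = c - X since deg ry < p, and all lines pass through
    (y, c). *)
Lemma card_meeting_abscissae_prime_field (F : finFieldType) (T : finType)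
    (a b : T -> F) (E := [set y | ~~ injectiveb (fun i => a i * y + b i)]) :
  #|F| \in [pchar F] -> (#|T| <= #|F|)%N -> (exists i j, a i != a j) ->
  (forall x y, exists i, a i * x + b i != y) -> (#|T| <= (2 * #|E|).+1)%N.
Proof.
move=> charF Tp [i0 [j0 aij]] spread; rewrite leqNgt; apply/negP => small.
have [y yE] : exists y, y \in E.
  exists ((b j0 - b i0) / (a i0 - a j0)); rewrite inE; apply/injectiveP => inj.
  have aij0 : a i0 - a j0 != 0 by rewrite subr_eq0.
  suff /inj ij : a i0 * ((b j0 - b i0) / (a i0 - a j0)) + b i0
      = a j0 * ((b j0 - b i0) / (a i0 - a j0)) + b j0 by rewrite ij eqxx in aij.
  by field.
have E0 : (0 < #|E|)%N by apply/card_gt0P; exists y.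
have [r [rE r_dvd]] := rem_total_degree_lacunary a b.
set vs := [seq a i * y + b i | i <- enum T].
pose ry := map_poly (horner_eval y) r; pose P : {poly F} := 'X^#|F| - 'X - ry.
have ry_size : (size ry <= #|E|.+1)%N by apply: leq_trans (size_poly _ _) rE.
have vs_P : \prod_(v <- vs) ('X - v%:P) %| P by exact: r_dvd.
have vs_root v : v \in vs -> ry.[v] = 0.
  move=> v_vs; have : root P v.
    rewrite -dvdp_XsubCl; apply: dvdp_trans vs_P.
    by rewrite dvdp_XsubCl root_prod_XsubC.
  by rewrite rootE !hornerE expf_card subrr sub0r oppr_eq0 => /eqP.
have P' : P^`() = - (1 + ry^`()).
  rewrite /P !derivB derivX derivXn.
  have -> : 'X^(#|F|.-1) *+ #|F| = 0 :> {poly F}.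
    by rewrite -mulr_natr -polyC_natr (pcharf0 charF) mulr0.
  by rewrite sub0r opprD.
have rad := prod_XsubC_dvdp_radical vs_P; rewrite P' mulrN dvdpNr in rad.
have sizeE s : size (\prod_(v <- s) ('X - v%:P) : {poly F}) = (size s).+1.
  exact: size_prod_XsubC.
have vs_size : size vs = #|T| by rewrite size_map -cardE.
have ry0 : ry != 0.
  apply: contraTneq yE => ry0; move: rad; rewrite ry0 deriv0 addr0 mulr1.
  move=> /dvdp_leq; rewrite -size_poly_gt0 !sizeE ltnS => /(_ isT) vs_undup.
  by rewrite inE negbK -[injectiveb _]/(uniq vs) -[uniq _]negbK -ltn_size_undup -leqNgt.
have [ry'|ry'] := eqVneq (1 + ry^`()) 0.
  have ry_hi m : (1 < m)%N -> ry`_m = 0.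
    move=> m1; have [Em|mE] := leqP #|E|.+1 m.
      by rewrite nth_default // (leq_trans ry_size).
    have := congr1 (fun g : {poly F} => g`_m.-1) ry'.
    rewrite coefD coef1 coef_deriv coef0 prednK ?(ltnW m1) //.
    have -> : (m.-1 == 0%N) = false by case: (m) m1 => [|[]].
    rewrite add0r -mulr_natr => /eqP; rewrite mulf_eq0 => /orP[/eqP //|].
    rewrite -(dvdn_pcharf charF) => /dvdn_leq; lia.
  have ry1 : ry`_1 = - 1.
    have := congr1 (fun g : {poly F} => g`_0) ry'.
    by rewrite coefD coef1 coef_deriv coef0 mulr1n addrC => /eqP; rewrite addr_eq0 => /eqP.
  have ryE : ry = (ry`_0)%:P - 'X.
    apply/polyP => -[|[|m]]; rewrite coefB coefC coefX /= ?subr0 //.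
      by rewrite sub0r.
    exact: ry_hi.
  have [i] := spread y ry`_0; case/eqP.
  have /vs_root : a i * y + b i \in vs by apply: map_f; rewrite mem_enum.
  by rewrite {1}ryE !hornerE => /eqP; rewrite subr_eq0 => /eqP.
have radical_ry : \prod_(v <- undup vs) ('X - v%:P) %| ry.
  apply: uniq_roots_dvdp; last by rewrite uniq_rootsE undup_uniq.
  by apply/allP => v; rewrite mem_undup rootE => /vs_root ->.
have := dvdp_leq _ (dvdp_trans rad (dvdp_mul radical_ry (dvdpp _))).
rewrite mulf_neq0 // sizeE vs_size size_mul // => /(_ isT).
have : (size (1 + ry^`())%R <= #|E|)%N.
  rewrite (leq_trans (size_polyD _ _)) // size_poly1 geq_max E0 /=.
  by rewrite -ltnS (leq_trans (lt_size_deriv ry0)).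
by move: (size _) (size _) ry_size small => s t; lia.
Qed.

(** * Counting in finite affine groups *)

Lemma leq_card_fset_finType (T : finType) (A : {fset T}) : (#|` A| <= #|T|)%N.
Proof. by rewrite cardfE; apply: leq_card (val_inj). Qed.

Lemma exists_many_secants_prime_field (F : finFieldType) (A : {fset aff F}) :
  #|F| \in [pchar F] -> (#|` A| <= #|F|)%N ->
  (exists g h, [/\ g \in A, h \in A & slope g != slope h]) ->
  (forall x y, exists2 g, g \in A & aff_app g x != y) ->
  exists2 D : {fset F}, forall x, x \in D -> secant A x & (#|` A| <= (2 * #|` D|).+1)%N.
Proof.
move=> charF AF [g [h [gA hA gh]]] spread.
pose a (i : A) := slope (val i); pose b (i : A) := intercept (val i).
pose E := [set y | ~~ injectiveb (fun i => a i * y + b i)].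
exists [fset y in E].
  move=> y; rewrite !inE => /injectivePn[i [j ij eqij]].
  by exists (val i), (val j); split; rewrite ?fsvalP //; apply: contraNneq ij => /val_inj ->.
rewrite card_finset; have -> : #|` A| = #|{: A}| by rewrite cardfE.
apply: card_meeting_abscissae_prime_field => //; first by rewrite -cardfE.
  by exists [` gA], [` hA].
by move=> x y; have [k kA kx] := spread x y; exists [` kA].
Qed.

(** Pigeonhole: A has more elements than there are values at x. *)
Lemma all_secants (F : finFieldType) (A : {fset aff F}) x :
  (#|F| < #|` A|)%N -> secant A x.
Proof.
move=> FA; have : ~~ injectiveb (fun i : A => aff_app (val i) x).
  by apply/injectiveP => /leq_card; rewrite -cardfE leqNgt FA.
case/injectivePn => i [j ij eqij].
by exists (val i), (val j); split; rewrite ?fsvalP //; apply: contraNneq ij => /val_inj ->.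
Qed.

Lemma exists_sub_of_large (F : finFieldType) (B : {fset F}) t :
  (#|F| < 2 * #|` B|)%N -> exists y z, [/\ y \in B, z \in B & y - z = t].
Proof.
move=> FB; pose Bt := [fset z + t | z in B].
have cardBt : #|` Bt| = #|` B| by apply: card_in_imfset => y z _ _ /addIr.
have /fset0Pn[y /fsetIP[yB /imfsetP[z /= zB yE]]] : B `&` Bt != fset0.
  rewrite -cardfs_gt0; have := cardfsUI B Bt; have := leq_card_fset_finType (B `|` Bt).
  by rewrite cardBt; move: #|F| #|` B| #|` B `|` Bt| #|` B `&` Bt| FB => f n u i; lia.
by exists y, z; rewrite yB zB yE addrC addKr.
Qed.

(** Some orbit has more than |F| / 2 points, so b / (1 - s) is a difference
    y - z of two of its points.  If c and d in A^4 have slope s and fix y and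
    z, then c d^-1 is the translation by (1 - s) (y - z) = b. *)
Lemma translations_powset8 (F : finFieldType) (A : {fset aff F}) b :
  symset A -> (#|F| < #|` A|)%N -> translation b \in powset A 8.
Proof.
move=> AV FA.
pose D := [fset x in F]; have cardD : #|` D| = #|F| by rewrite card_finset.
have F0 : (0 < #|F|)%N by apply/card_gt0P; exists 0.
have [|x _] := @exists_large_orbit _ A D; first by rewrite -cardfs_gt0 cardD.
rewrite cardD => large.
have [s s1 conj] := conjugates_over_orbit AV (all_secants x FA).
have s10 : 1 - s != 0 by rewrite subr_eq0 eq_sym.
have [|y [z [yO zO yz]]] := @exists_sub_of_large _ (orbit_of A x) (b / (1 - s)).
  by move: #|F| #|` A| #|` orbit_of A x| FA F0 large => f n o; nia.
have [c [cA sc cy]] := conj y yO; have [d [dA sd dz]] := conj z zO.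
suff -> : translation b = (c * d^-1)%g.
  by apply: (@mem_powset_mul _ _ 4 4) => //; apply: powset_inv.
apply: (@aff_eq_app _ _ _ z); first by rewrite slopeM slopeV sc sd mulfV // -sc slope_neq0.
rewrite aff_app_mul -{2}dz aff_appK.
have bE : b = (y - z) * (1 - s) by rewrite yz divfK.
have iE : intercept c = y - s * y by rewrite -{1}cy /aff_app sc addrC addKr.
by rewrite /aff_app sc iE /slope /intercept /= bE; ring.
Qed.

(** In a prime field the multiples of b are all of F, so the subgroup A^2
    contains all translations.  It also contains g a, for a fixed a in A and one
    g in A of each slope; the products of the former by the latter are distinct. *)
Lemma card_slopes_translation (F : finFieldType) (A : {fset aff F}) b :
  #|F| \in [pchar F] -> symset A -> (2 <= #|` A|)%N ->
  (2 * #|` powset A 2| < 3 * #|` A|)%N -> b != 0 -> translation b \in powset A 2 ->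
  (#|` slopes A| * #|F| <= #|` powset A 2|)%N.
Proof.
move=> charF AV A2 small b0 bH.
have allT c : translation c \in powset A 2.
  have inj : injective (fun k : 'I_#|F| => b *+ k).
    move=> k l; wlog kl : k l / (k <= l)%N.
      by move=> wl eqkl; case: (leqP k l) => [|/ltnW] /wl -> //.
    move=> /eqP; rewrite eq_sym -subr_eq0 -mulrnBr // -mulr_natr mulf_eq0 (negPf b0) /=.
    rewrite -(dvdn_pcharf charF) => dvd; apply/val_inj/eqP => /=.
    rewrite eqn_leq kl -subn_eq0 /= -leqn0 leqNgt; apply/negP => /dvdn_leq/(_ dvd).
    by rewrite leqNgt (leq_ltn_trans (leq_subr _ _) (ltn_ord l)).
  have [g _ gK] := inj_card_bij inj (eq_leq (esym (card_ord #|F|))).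
  by rewrite -(gK c); apply: translation_mulrn.
have /fset0Pn[a aA] : A != fset0 by rewrite -cardfs_gt0; apply: ltnW.
have [r rP] := exists_slope_section A.
have <- : #|` [fset x in F]| = #|F| by rewrite card_finset.
rewrite -card_fsetM.
apply: (@leq_card_fset_in _ _ _ _ (fun u => (translation u.2 * (r u.1 * a))%g)).
  move=> [s c] [t d] /[!in_fsetM] /= /andP[sS _] /andP[tS _] eqst.
  have [_ rs] := rP _ sS; have [_ rt] := rP _ tS.
  have st : s = t.
    have := congr1 (@slope F) eqst; rewrite !slopeM rs rt !mul1r.
    by apply: mulIf; apply: slope_neq0.
  by move: eqst; rewrite st => /mulIg/(congr1 (@intercept F)); rewrite /intercept /= => ->.
move=> [s c] /[!in_fsetM] /= /andP[sS _]; have [rA _] := rP _ sS.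
apply: powset2_closed => //.
by rewrite -[2%N]addn1 mem_powset_mul ?powset1.
Qed.

(** * Bounds by the tripling constant *)

Lemma powset2_leq_powset3 (G : groupType) (A : {fset G}) :
  A != fset0 -> (#|` powset A 2| <= #|` powset A 3|)%N.
Proof.
case/fset0Pn => a aA; apply: (@leq_card_fset_in _ _ _ _ (fun x => (a * x)%g)).
  by move=> x y _ _ /mulgI.
by move=> x xA; apply: (@mem_powset_mul _ _ 1 2); rewrite ?powset1.
Qed.

Lemma tripling_ge1 (R : realType) (G : groupType) (A : {fset G}) :
  symset A -> A != fset0 -> 1 <= tripling R A.
Proof.
move=> AV A0; rewrite /tripling ler_pdivlMr ?ltr0n ?cardfs_gt0 // mul1r ler_nat.
apply/fsubset_leq_card/fsubsetP => x xA; apply: (@subset_powset _ _ 1 1) => //.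
by rewrite powset1.
Qed.

Lemma slopes_secants_tripling (R : realType) (F : fieldType) (A : {fset aff F})
    (D : {fset F}) :
  symset A -> A != fset0 -> D != fset0 -> (forall x, x \in D -> secant A x) ->
  (#|` slopes A| * #|` D|)%:R
    <= tripling R A ^+ 3 * (#|` D| + #|` A|.-1)%:R.
Proof.
move=> AV A0 D0 Dsec; have := card_slopes_secants AV D0 Dsec.
have n0 : 0 < (#|` A|%:R : R) by rewrite ltr0n cardfs_gt0.
rewrite -(ler_nat R) natrM natrX [X in _ <= X -> _]natrM natrX => le3.
by rewrite /tripling expr_div_n mulrAC ler_pdivlMr ?exprn_gt0.
Qed.

(** D is so large that |D| + |A| - 1 <= 3 |D|, and 3 <= 2 K. *)
Lemma slopes_le_2K4 (R : realType) (F : fieldType) (A : {fset aff F})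
    (D : {fset F}) :
  symset A -> (2 <= #|` A|)%N -> (forall x, x \in D -> secant A x) ->
  (#|` A| <= (2 * #|` D|).+1)%N -> (3 * #|` A| <= 2 * #|` powset A 3|)%N ->
  (#|` slopes A|)%:R <= 2 * tripling R A ^+ 4.
Proof.
move=> AV A2 Dsec AD big.
have A0 : A != fset0 by rewrite -cardfs_gt0; apply: ltnW.
have D0 : D != fset0.
  by rewrite -cardfs_gt0; move: #|` A| #|` D| A2 AD => n d; lia.
have K1 := tripling_ge1 R AV A0.
have K32 : 3 <= 2 * tripling R A.
  by rewrite /tripling mulrA ler_pdivlMr ?ltr0n ?cardfs_gt0 // -!natrM ler_nat.
have := slopes_secants_tripling R AV A0 D0 Dsec.
have d0 : 0 < (#|` D|%:R : R) by rewrite ltr0n cardfs_gt0.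
have : (#|` D| + #|` A|.-1)%:R <= 3 * #|` D|%:R :> R.
  by rewrite -natrM ler_nat; move: #|` A| #|` D| AD => n d; lia.
move: (tripling R A) K1 K32 => K K1 K32 le3 bound.
rewrite -(ler_pM2r d0) -natrM; apply: (le_trans bound).
have K30 : 0 <= K ^+ 3 by rewrite exprn_ge0 // (le_trans ler01).
apply: (le_trans (ler_wpM2l K30 le3)).
move: (#|` D|%:R : R) d0 => d d0.
have -> : K ^+ 3 * (3 * d) = 3 * (K ^+ 3 * d) by ring.
have -> : 2 * K ^+ 4 * d = 2 * K * (K ^+ 3 * d) by ring.
by rewrite ler_wpM2r // mulr_ge0 // ltW.
Qed.

Lemma few_slopes_le_2K4 (R : realType) (F : fieldType) (A : {fset aff F}) :
  symset A -> A != fset0 -> (#|` slopes A| <= 2)%N ->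
  (#|` slopes A|)%:R <= 2 * tripling R A ^+ 4.
Proof.
move=> AV A0 s2; apply: (@le_trans _ _ 2); first by rewrite ler_nat.
by rewrite ler_peMr // exprn_ege1 // tripling_ge1.
Qed.

Lemma card_slopes_const (F : fieldType) (A : {fset aff F}) :
  ~ (exists g h, [/\ g \in A, h \in A & slope g != slope h]) ->
  (#|` slopes A| <= 1)%N.
Proof.
move=> const; have [->|/fset0Pn[s sS]] := eqVneq (slopes A) fset0.
  by rewrite cardfs0.
rewrite -(cardfs1 s); apply/fsubset_leq_card/fsubsetP => t tS; rewrite inE.
apply: contrapT => /negP ts; apply: const.
have [/imfsetP[g /= gA tE] /imfsetP[h /= hA sE]] := (tS, sS).
by exists g, h; rewrite -tE -sE.
Qed.

Lemma concurrent_or_spread (F : fieldType) (A : {fset aff F}) :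
  symset A -> (2 <= #|` A|)%N ->
  (exists x, {subset A <= Stab x}) \/
  (forall x y, exists2 g, g \in A & aff_app g x != y).
Proof.
move=> AV A2; case: (pselect (exists x y, forall g, g \in A -> aff_app g x = y)).
  by move=> [x [y Axy]]; left; exists x; apply: symset_concurrent_Stab Axy.
move=> none; right => x y; apply: contrapT => /forall2NP all.
apply: none; exists x, y => g gA; apply/eqP; apply: contrapT => /negP gxy.
by case: (all g).
Qed.

(** Its powers would be infinitely many elements of A^2. *)
Lemma no_torsion_translation (R : realFieldType) (A : {fset aff R}) b :
  symset A -> (2 <= #|` A|)%N -> (2 * #|` powset A 2| < 3 * #|` A|)%N ->
  b != 0 -> translation b \notin powset A 2.
Proof.
move=> AV A2 small b0; apply/negP => bH.
pose f (k : 'I_#|` powset A 2|.+1) : powset A 2 :=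
  [` translation_mulrn k AV A2 small bH].
have /leq_card : injective f.
  move=> k l /(congr1 (fun u => intercept (val u))).
  rewrite /intercept /= -!(mulr_natr b) => /(mulfI b0)/eqP.
  by rewrite eqr_nat => /eqP; apply: val_inj.
by rewrite card_ord -cardfE ltnn.
Qed.

(** * Growth in the affine group *)

Theorem theorem5 (R : realType) :
  (exists2 C : R, 1 <= C &
   exists p0 : nat, forall p : nat,
     prime p -> odd p -> (p0 < p)%N ->
   forall A : {fset aff 'F_p},
     symset A -> (2 <= #|` A|)%N ->
     let K : R := tripling R A in
     (exists x : 'F_p, {subset A <= Stab x})
     \/
     (forall eps : R, 0 < eps -> eps < 1 ->
        ((#|` A|)%:R <= (1 + eps) * p%:R ->
           (#|` slopes A|)%:R <= 2 * K ^+ 4)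
        /\
        ((1 + eps) * p%:R < (#|` A|)%:R ->
           (#|` slopes A|)%:R <= C * eps `^ (- C) * K ^+ 3 * ((#|` A|)%:R / p%:R)
           /\
           ((4 * p < #|` A|)%N ->
              (#|` slopes A|)%:R <= 2 * K ^+ 3 * ((#|` A|)%:R / p%:R)
              /\ (forall b : 'F_p, translation b \in powset A 8)))))
  /\
  (forall A : {fset aff R},
     symset A -> (2 <= #|` A|)%N ->
     let K : R := tripling R A in
     (exists x : R, {subset A <= Stab x})
     \/ (#|` slopes A|)%:R <= 2 * K ^+ 4).
Proof.
split; last first.
  move=> A AV A2 K; have A0 : A != fset0 by rewrite -cardfs_gt0; apply: ltnW.
  have [|spread] := concurrent_or_spread AV A2; [by left|right].
  have [two|/card_slopes_const const] := pselect
      (exists g h, [/\ g \in A, h \in A & slope g != slope h]); last first.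
    exact: (few_slopes_le_2K4 R AV A0 (leqW const)).
  have [big|small] := leqP (3 * #|` A|) (2 * #|` powset A 3|).
    have [D Dsec AD] := exists_many_secants_real two spread.
    exact: (slopes_le_2K4 R AV A2 Dsec AD big).
  have small2 : (2 * #|` powset A 2| < 3 * #|` A|)%N.
    by apply: leq_ltn_trans small; rewrite leq_mul2l powset2_leq_powset3.
  have [b b0 bH] := small_doubling_translation AV A2 small2 spread.
  by have := no_torsion_translation AV A2 small2 b0; rewrite bH.
exists 2; first lra.
exists 0%N => p p_pr _ _ A AV A2 K.
have A0 : A != fset0 by rewrite -cardfs_gt0; apply: ltnW.
have [|spread] := concurrent_or_spread AV A2; [by left|right => eps e0 e1].
have Fp : #|'F_p| = p by rewrite card_Fp.
have charF : #|'F_p| \in [pchar 'F_p] by rewrite Fp; exact: pchar_Fp.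
have p0 : 0 < (p%:R : R) by rewrite ltr0n prime_gt0.
have K1 : 1 <= K := tripling_ge1 R AV A0.
pose D : {fset 'F_p} := [fset x in 'F_p].
have cardD : #|` D| = p by rewrite card_finset.
have D0 : D != fset0 by rewrite -cardfs_gt0 cardD prime_gt0.
split=> [Ale|Agt].
  have [two|/card_slopes_const const] := pselect
      (exists g h, [/\ g \in A, h \in A & slope g != slope h]); last first.
    exact: (few_slopes_le_2K4 R AV A0 (leqW const)).
  have A2p : (#|` A| < 2 * p)%N by rewrite -(ltr_nat R) natrM; nra.
  have [big|small] := leqP (3 * #|` A|) (2 * #|` powset A 3|).
    have [Ap|pA] := leqP #|` A| p.
      have [|E Esec AE] := exists_many_secants_prime_field charF _ two spread.
        by rewrite Fp.
      exact: (slopes_le_2K4 R AV A2 Esec AE big).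
    apply: (@slopes_le_2K4 R _ A D) => //; last by rewrite cardD ltnW // ltnW.
    by move=> x _; apply: all_secants; rewrite Fp.
  have small2 : (2 * #|` powset A 2| < 3 * #|` A|)%N.
    by apply: leq_ltn_trans small; rewrite leq_mul2l powset2_leq_powset3.
  have [b b0 bH] := small_doubling_translation AV A2 small2 spread.
  have := card_slopes_translation charF AV A2 small2 b0 bH; rewrite Fp => few.
  apply: few_slopes_le_2K4 => //.
  move: #|` slopes A| #|` A| #|` powset A 2| A2p small2 few => s n m; nia.
have pA : (#|'F_p| < #|` A|)%N by rewrite Fp -(ltr_nat R); nra.
(* With C = 2 this gives the bound in terms of eps, since eps `^ (- 2) >= 1. *)
have bound : #|` slopes A|%:R <= 2 * K ^+ 3 * (#|` A|%:R / p%:R).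
  have := @slopes_secants_tripling R _ A D AV A0 D0 (fun x _ => all_secants x pA).
  rewrite cardD natrM -/K mulrA ler_pdivlMr // => le3.
  apply: (le_trans le3); rewrite [2 * _]mulrC -[leRHS]mulrA.
  apply: ler_wpM2l; first by rewrite exprn_ge0 // (le_trans ler01).
  by rewrite -natrM ler_nat; move: pA; rewrite Fp; move: #|` A| => n; lia.
split; last by split=> // b; apply: translations_powset8.
apply: (le_trans bound); rewrite -[leRHS]mulrA -[leLHS]mulrA.
rewrite -(mulrA 2 (eps `^ _)) ler_pM2l // ler_peMl //.
  by rewrite mulr_ge0 ?divr_ge0 // exprn_ge0 // (le_trans ler01).
by rewrite powRN (powR_mulrn _ (ltW e0)) invf_ge1 ?exprn_gt0 // exprn_ile1 // ltW.
Qed.
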